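(* Let $\frac{m-1}{2}\le r\le m$. By applying decoders on the qubit subsets $Q^{(m)}(\mathbf s;\mathbf t)$ of the encoded states $|\mathbf w\rangle_{r,m}$ of $\mathrm{QRM}(r,m)$, one obtains entangled pairs of qubits across the partitions. For instance, applying the decoders of $\mathrm{QRM}(r,m-1)$ (the inverses of the encoder $U(r,m-1)$) on the qubit sets $Q^{(m)}(1;0)$ and $Q^{(m)}(1;1)$ of the state $|\mathbf 0\rangle_{r,m}$ with $r<m-1$, one obtains $\binom{m-1}{m-r-1}$ Bell pairs across this partition. In general, one can obtain at least $\binom{m-l}{m-r-1}$ $2^l$-party GHZ states by considering partitions consisting of such subsets of $2^{m-l}$ qubits.
   Context: For $0\le r\le m$, $\mathrm{RM}(r,m)\subseteq\mathbb F_2^{2^m}$ is the binary Reed-Muller code: the set of evaluation vectors $\mathrm{Eval}^{(m)}(f)=(f(\boldsymbol\rho(1)),\dots,f(\boldsymbol\rho(2^m)))$ of polynomials $f\in\mathbb F_2[x_1,\dots,x_m]$ of degree at most $r$, where $\boldsymbol\rho(j)$ is the $m$-bit binary representation of $j-1$ (first coordinate most significant). One has $\mathrm{RM}(r,m)^\perp=\mathrm{RM}(m-r-1,m)$, with $\mathrm{RM}(s,m)=\{\mathbf 0\}$ for $s<0$. For $(m-1)/2\le r\le m$, $\mathrm{QRM}(r,m)$ is the CSS code with basis codewords $|\mathbf w\rangle_{r,m}=|\mathrm{RM}(r,m)^\perp|^{-1/2}\sum_{\mathbf c\in\mathrm{RM}(r,m)^\perp}|\mathbf w\oplus\mathbf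 c\rangle$, $\mathbf w\in\mathrm{RM}(r,m)$. **Qubit subsets.** The qubits are $q_1,\dots,q_{2^m}$; $Q^{(m)}(i;k)=\{q_j:\mathrm{Eval}^{(m)}(x_i)_j=k\}$, and for $\mathbf s=(s_1,\dots,s_l)$, $\mathbf t=(t_1,\dots,t_l)$ with $s_i\in\{1,\dots,m\}$, $t_i\in\{0,1\}$, $Q^{(m)}(\mathbf s;\mathbf t)=\bigcap_{i=1}^lQ^{(m)}(s_i;t_i)$. **Encoders and decoders.** A decoder is the inverse $U^\dagger$ of an encoder; on a subset of $2^{m-l}$ qubits the decoder is that of the shorter code $\mathrm{QRM}(r,m-l)$. $U(r,m)$ is the following recursively built encoder. $G(r,m)$ is the matrix whose rows are the evaluation vectors of monomials of degree at most $r$ (no rows if $r<0$); $A\setminus B$ is the matrix of rows of $A$ that are not rows of $B$; vectors of length $2^m$ are written as pairs of vectors of length $2^{m-1}$. If $G$ has rows $\mathbf g_1,\mathbf g_2,\dots$, its row index map is $M[\mathbf g_i]=i$. $P(p)$ moves the qubit at position $i$ to position $p(i)$; only the listed values of $p$ are prescribed. $\mathrm{CNOT}(i\to j)$ has control $i$ and target $j$. $U(m,m)$ (index map $M$ of $G(m,m)$): $U(0,0)$ is the identity on one qubit; for $m\ge1$, with $M_1$ the index map of $U(m-1,m-1)$, apply $P(p)$ with $p(M[(\mathbf u,\mathbf u)])=M_1[\mathbf u]$ and $p(M[(\mathbf 0,\mathbf v)])=2^{m-1}+M_1[\mathbf v]$ for rows $\mathbf u,\mathbf v$ of $G(m-1,m-1)$;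 then $\mathrm{CNOT}(M_1[\mathbf u]\to2^{m-1}+M_1[\mathbf u])$ for all these $\mathbf u$; then $U(m-1,m-1)^{\otimes2}$. $U(r,m)$ for $\frac{m-1}2\le r<m$: let $M$ be the index map of the matrix whose rows are those of $G(r,m)\setminus G(m-r-1,m)$ followed by $(\mathbf g,\mathbf g)$ for $\mathbf g$ in $G(m-r-1,m-1)\setminus G(m-r-2,m-1)$, and $M_1$ that of $U(r,m-1)$. Apply Hadamard gates on qubits $k+1,\dots,k+\binom{m-1}{m-r-1}$, $k=\sum_{i=m-r}^r\binom mi$; then $P(p)$ with $p(M[(\mathbf u,\mathbf u)])=M_1[\mathbf u]$ for $\mathbf u\in G_3=G(r,m-1)\setminus G(m-r-2,m-1)$ and $p(M[(\mathbf 0,\mathbf v)])=2^{m-1}+M_1[\mathbf v]$ for $\mathbf v\in G(r-1,m-1)\setminus G(m-r-2,m-1)$; then $\mathrm{CNOT}(M_1[\mathbf u]\to2^{m-1}+M_1[\mathbf u])$ for $\mathbf u\in G_3$; then $U(r,m-1)^{\otimes 2}$. A Bell pair is $\frac1{\sqrt2}(|00\rangle+|11\rangle)$; a $2^l$-party GHZ state is $\frac{1}{\sqrt2}(|0\rangle^{\otimes 2^l}+|1\rangle^{\otimes 2^l})$ shared by the $2^l$ parts of the partition. *)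

(* Defs.v *)
From HB Require Import structures.
From mathcomp Require Import all_boot all_order all_fingroup all_algebra.
From mathcomp Require Import boolp.
From mathcomp Require Import mpoly.

Set Implicit Arguments.
Unset Strict Implicit.
Unset Printing Implicit Defensive.

Import Order.TTheory GRing.Theory Num.Theory.
Local Open Scope ring_scope.

(* Qubits, coordinates and variables are numbered from 0: [j : 'I_(2 ^ m)]
   stands for q_(j+1), and [i : 'I_m] for x_(i+1). Degrees are integers, as
   m - r - 1 and m - r - 2 may be negative. *)

Notation word n := 'rV['F_2]_n.

(* the [m]-bit expansion of [j], most significant bit first *)
Definition rho m (j : 'I_(2 ^ m)) (i : 'I_m) : 'F_2 :=
  (odd (j %/ 2 ^ (m - i.+1)))%:R.

Definition Eval m (f : {mpoly 'F_2[m]}) : word (2 ^ m) :=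
  \row_j f.@[rho j].

(* total degree at most [r]; the zero polynomial satisfies it for every [r] *)
Definition deg_le m (r : int) (f : {mpoly 'F_2[m]}) : Prop :=
  forall mon, mon \in msupp f -> (mdeg mon)%:Z <= r.

Definition RM (r : int) m : {set word (2 ^ m)} :=
  [set c | `[< exists2 f : {mpoly 'F_2[m]}, deg_le r f & c = Eval f >]].

Definition dual_code n (A : {set word n}) : {set word n} :=
  [set c | [forall w in A, w *m c^T == 0]].

(* [G r m] lists the rows of G(r, m). Distinct monomials such as x_1 and x_1^2
   have the same evaluation vector, which is one row. The order of the rows is
   left free. *)
Definition monomial_rows (G : int -> forall m, seq (word (2 ^ m))) : Prop :=
  forall r m, uniq (G r m) /\
    forall v, v \in G r m <->
      exists2 mon : 'X_{1..m}, (mdeg mon)%:Z <= r & v = Eval 'X_[mon].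

Definition rows_diff n (A B : seq (word n)) : seq (word n) :=
  [seq v <- A | v \notin B].

Lemma double_pow2 m : (2 ^ m + 2 ^ m = 2 ^ m.+1)%N.
Proof. by rewrite addnn expnS mul2n. Qed.

Definition lo m (j : 'I_(2 ^ m)) : 'I_(2 ^ m.+1) :=
  cast_ord (double_pow2 m) (lshift (2 ^ m) j).

Definition hi m (j : 'I_(2 ^ m)) : 'I_(2 ^ m.+1) :=
  cast_ord (double_pow2 m) (rshift (2 ^ m) j).

Definition wpair m (u v : word (2 ^ m)) : word (2 ^ m.+1) :=
  castmx (erefl, double_pow2 m) (row_mx u v).

Definition lo_word m (x : word (2 ^ m.+1)) : word (2 ^ m) :=
  \row_j x 0 (lo j).

Definition hi_word m (x : word (2 ^ m.+1)) : word (2 ^ m) :=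
  \row_j x 0 (hi j).

Lemma pow2_gt0 m : (0 < 2 ^ m)%N.
Proof. by rewrite expn_gt0. Qed.

Definition qubit0 m : 'I_(2 ^ m) := Ordinal (pow2_gt0 m).

(* The default [qubit0] is never reached for [g] in [rows], as the lists of
   rows considered have at most 2 ^ m elements. *)
Definition index_map m (rows : seq (word (2 ^ m))) (g : word (2 ^ m)) :
  'I_(2 ^ m) := insubd (qubit0 m) (index g rows).

Section Quantum.
Variable C : numClosedFieldType.

(* amplitudes in the computational basis *)
Definition qstate n := word n -> C.

(* [A y x] is the matrix coefficient <y| A |x> *)
Definition qop n := word n -> word n -> C.

Definition app_op n (A : qop n) (psi : qstate n) : qstate n :=
  fun y => \sum_x A y x * psi x.

Definition id_op n : qop n := fun y x => (y == x)%:R.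

(* time order: first [A], then [B] *)
Definition then_op n (A B : qop n) : qop n :=
  fun z x => \sum_y B z y * A y x.

Definition adjoint n (A : qop n) : qop n := fun y x => (A x y)^*.

Definition circuit n (gates : seq (qop n)) : qop n :=
  foldr (@then_op n) (@id_op n) gates.

Definition hadamard n (i : 'I_n) : qop n := fun y x =>
  ([forall (j | j != i), y 0 j == x 0 j])%:R *
  ((sqrtC 2%:R)^-1 * (-1) ^+ (x 0%R i * y 0%R i)%N).

Definition cnot n (i j : 'I_n) : qop n := fun y x =>
  (y == x + x 0 i *: delta_mx 0 j)%:R.

(* the qubit at position [i] moves to position [p i] *)
Definition perm_op n (p : {perm 'I_n}) : qop n := fun y x =>
  ([forall i, y 0 (p i) == x 0 i])%:R.

Definition tensor2 m (A B : qop (2 ^ m)) : qop (2 ^ m.+1) := fun y x =>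
  A (lo_word y) (lo_word x) * B (hi_word y) (hi_word x).

Definition hadamards n (a b : nat) : qop n :=
  circuit [seq hadamard i | i : 'I_n <- enum 'I_n & (a <= i < b)%N].

Definition cnot_halves m (M1 : seq (word (2 ^ m))) (us : seq (word (2 ^ m))) :
  qop (2 ^ m.+1) :=
  circuit [seq cnot (lo (index_map M1 u)) (hi (index_map M1 u)) | u <- us].

(* [encoder G r M U]: [U] is an encoder U(r, m) with index map that of the list
   of rows [M]. It is a relation because the recursion prescribes only part of
   each permutation [p]. *)
Inductive encoder (G : int -> forall m, seq (word (2 ^ m))) :
    nat -> forall m, seq (word (2 ^ m)) -> qop (2 ^ m) -> Prop :=
| encoder_00 : encoder G 0 (G 0 0%N) (@id_op (2 ^ 0))
| encoder_full (m : nat) (M1 : seq (word (2 ^ m))) (U1 : qop (2 ^ m))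
    (p : {perm 'I_(2 ^ m.+1)}) :
    let M := G m.+1 m.+1 in
    encoder G m M1 U1 ->
    (forall u, u \in G m m ->
       p (index_map M (wpair u u)) = lo (index_map M1 u)) ->
    (forall v, v \in G m m ->
       p (index_map M (wpair 0 v)) = hi (index_map M1 v)) ->
    encoder G m.+1 M
      (circuit [:: perm_op p; cnot_halves M1 (G m m); tensor2 U1 U1])
| encoder_rec (r m : nat) (M1 : seq (word (2 ^ m))) (U1 : qop (2 ^ m))
    (p : {perm 'I_(2 ^ m.+1)}) :
    let n := m.+1 in
    let d : int := n%:Z - r%:Z - 1 in
    let M := rows_diff (G r n) (G d n) ++
             [seq wpair g g | g <- rows_diff (G d m) (G (d - 1) m)] in
    let k := (\sum_(n - r <= i < r.+1) 'C(n, i))%N in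
    let G3 := rows_diff (G r m) (G (d - 1) m) in
    (n - 1 <= r.*2)%N -> (r < n)%N ->
    encoder G r M1 U1 ->
    (forall u, u \in G3 ->
       p (index_map M (wpair u u)) = lo (index_map M1 u)) ->
    (forall v, v \in rows_diff (G (r%:Z - 1) m) (G (d - 1) m) ->
       p (index_map M (wpair 0 v)) = hi (index_map M1 v)) ->
    encoder G r M
      (circuit [:: @hadamards (2 ^ n) k (k + 'C(n - 1, n - r - 1));
                   perm_op p; cnot_halves M1 G3; tensor2 U1 U1]).

(* the basis codeword |w>_{r,m} of QRM(r, m), for [w] in [RM r m] *)
Definition codeword_state (r m : nat) (w : word (2 ^ m)) : qstate (2 ^ m) :=
  let D := dual_code (RM r m) in
  fun x => (sqrtC #|D|%:R)^-1 * \sum_(c in D) (x == w + c)%:R.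

Definition Q1 m (i : 'I_m) (k : 'F_2) : {set 'I_(2 ^ m)} :=
  [set j | Eval 'X_i 0 j == k].

Definition Q m l (s : l.-tuple 'I_m) (t : l.-tuple 'F_2) : {set 'I_(2 ^ m)} :=
  \bigcap_(i < l) Q1 (tnth s i) (tnth t i).

(* The [j]-th qubit of Q(s; t), in increasing order. For distinct entries of
   [s], Q(s; t) has exactly 2 ^ (m - l) elements. *)
Definition Q_nth m l (s : l.-tuple 'I_m) (t : l.-tuple 'F_2)
    (j : 'I_(2 ^ (m - l))) : 'I_(2 ^ m) :=
  nth (qubit0 m) (enum (Q s t)) j.

Definition Q_word m l (s : l.-tuple 'I_m) (t : l.-tuple 'F_2)
    (x : word (2 ^ m)) : word (2 ^ (m - l)) :=
  \row_j x 0 (Q_nth s t j).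

(* [A] on each of the 2 ^ l parts Q(s; t), t in {0,1}^l *)
Definition on_parts m l (s : l.-tuple 'I_m) (A : qop (2 ^ (m - l))) :
  qop (2 ^ m) :=
  fun y x => \prod_t A (Q_word s t y) (Q_word s t x).

Definition decode m l (s : l.-tuple 'I_m) (U : qop (2 ^ (m - l)))
    (psi : qstate (2 ^ m)) : qstate (2 ^ m) :=
  app_op (on_parts s (adjoint U)) psi.

(* basis states of 2 ^ l qubits, one in each part *)
Definition party_word l := {ffun l.-tuple 'F_2 -> 'F_2}.
Definition party_state l := party_word l -> C.

Definition ghz l : party_state l := fun x =>
  (sqrtC 2%:R)^-1 *
  (([forall t, x t == 0])%:R + ([forall t, x t == 1])%:R).

(* |00> + |11> over sqrt 2, between the parts t = (0) and t = (1) *)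
Definition bell_pair : party_state 1 := @ghz 1.

(* (the tensor product of the X^(b t)) |GHZ> *)
Definition flipped_ghz l (b : party_word l) : party_state l :=
  fun x => ghz [ffun t => x t + b t].

(* not a product across any bipartition of the parties; for l = 1, the usual
   notion for a pair of qubits *)
Definition entangled l (eta : party_state l) : Prop :=
  forall A : {set l.-tuple 'F_2}, A != set0 -> A != [set: l.-tuple 'F_2] ->
  ~ exists f g : party_state l,
      [/\ forall x x' : party_word l, {in A, x =1 x'} -> f x = f x',
          forall x x' : party_word l, {in ~: A, x =1 x'} -> g x = g x'
        & forall x, eta x = f x * g x].

(* [e a t] is the position, within the part Q(s; t), of the qubit held by that
   part in the [a]-th shared state *)
Definition share_word m l (s : l.-tuple 'I_m) k
    (e : 'I_k -> l.-tuple 'F_2 -> 'I_(2 ^ (m - l))) (a : 'I_k)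
    (x : word (2 ^ m)) : party_word l :=
  [ffun t => x 0 (Q_nth s t (e a t))].

(* [psi] is the tensor product of the states [eta a], each on one qubit of every
   part (no qubit being used twice), and of a state [chi] of the other qubits *)
Definition obtains m l (s : l.-tuple 'I_m) k (eta : 'I_k -> party_state l)
    (psi : qstate (2 ^ m)) : Prop :=
  exists (e : 'I_k -> l.-tuple 'F_2 -> 'I_(2 ^ (m - l))) (chi : qstate (2 ^ m)),
  [/\ forall t, injective (e^~ t),
      forall x x' : word (2 ^ m),
        (forall t j, (forall a, e a t != j) ->
           x 0 (Q_nth s t j) = x' 0 (Q_nth s t j)) ->
        chi x = chi x'
    & forall x, psi x = (\prod_a eta a (share_word s e a x)) * chi x].

(* the same, with the other qubits not entangled across the parts: the states
   [eta a] are all the entanglement there is across the partition *)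
Definition obtains_exactly m l (s : l.-tuple 'I_m) k
    (eta : 'I_k -> party_state l) (psi : qstate (2 ^ m)) : Prop :=
  exists (e : 'I_k -> l.-tuple 'F_2 -> 'I_(2 ^ (m - l)))
         (chi : l.-tuple 'F_2 -> qstate (2 ^ (m - l))),
  [/\ forall t, injective (e^~ t),
      forall t (x x' : word (2 ^ (m - l))),
        (forall j, (forall a, e a t != j) -> x 0 j = x' 0 j) ->
        chi t x = chi t x'
    & forall x, psi x = (\prod_a eta a (share_word s e a x)) *
                        \prod_t chi t (Q_word s t x)].

End Quantum.

Arguments id_op {C n}.
Arguments ghz {C l}.
Arguments bell_pair {C}.
Arguments flipped_ghz {C l}.
Arguments codeword_state {C} r {m}.

(* binomial coefficient with an integer lower index, 0 when it is negative:
   'C(n, m - r - 1) with truncated subtraction would be 1 for r = m *)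
Definition binz (n : nat) (k : int) : nat :=
  if k is Posz j then 'C(n, j) else 0%N.

(* Main.v *)
Require Import Defs.
From HB Require Import structures.
From mathcomp Require Import all_boot all_order all_fingroup all_algebra.
From mathcomp Require Import boolp mpoly zify.

(* Words are handled through their algebraic normal form: [anf y S] is the
   coefficient of the monomial x_S = prod_(i in S) x_i in the polynomial of [y].
   RM(r, m)^perp consists of the words with [anf y S = 0] whenever |S| >= m - r.

   By induction on m, the encoder U(r, m) sends a basis state whose bits at the
   positions M[x_S], m - r <= |S| <= r, are a_S, the other bits being 0, to the
   codeword state of sum_S a_S x_S: the Hadamard gates create the sum over the
   monomials of degree m - r - 1 not containing x_1, and the CNOT gates implement
   f(0, y) = u(y), f(1, y) = u(y) + v(y) for f = u + x_1 v. Since U is an isometry,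
   the decoder reads the coefficients a_S off a codeword state.

   The restriction of a word [y] to Q(s; t) has the coefficients
   sum_(A included in {i | t_i = 1}) anf y (s_A union S). When [y] is in RM(m - r - 1, m)
   and |S| = m - r - 1, only A = empty contributes. Hence the bit decoded in the part t
   at the position of x_S does not depend on t, and it is not constrained by anything
   else, as x_S itself belongs to RM(m - r - 1, m): each of the binom(m - l, m - r - 1)
   sets S gives a GHZ state, with bits flipped according to w. For l = 1, all the other
   coefficients that are decoded vanish. *)

Set Implicit Arguments.
Unset Strict Implicit.
Unset Printing Implicit Defensive.

Import Order.TTheory GRing.Theory Num.Theory.
Local Open Scope ring_scope.

(** * Arithmetic modulo 2 and binary expansions *)

(* Terms [#|S|] with [S : {set 'I_m}] may differ by [reverse_coercion], which [lia]
   does not see through. *)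
Ltac card_lia := unfold reverse_coercion in *; lia.

Lemma F2_cases (x : 'F_2) : x = 0 \/ x = 1.
Proof.
by case: x => [[|[|//]] lt_x]; [left | right]; apply: val_inj.
Qed.

Lemma F2_addxx (x : 'F_2) : x + x = 0.
Proof. by case: (F2_cases x) => ->; apply: val_inj. Qed.

Lemma F2_addbb n (x : word n) : x + x = 0.
Proof. by apply/rowP => j; rewrite !mxE F2_addxx. Qed.

Lemma F2_natr_odd k : k%:R = (odd k)%:R :> 'F_2.
Proof.
rewrite -{1}[k]odd_double_half natrD -muln2 natrM.
by rewrite (_ : 2%:R = 0 :> 'F_2) ?mulr0 ?addr0 //; apply: val_inj.
Qed.

Definition supp m (j : 'I_(2 ^ m)) : {set 'I_m} :=
  [set i : 'I_m | odd (j %/ 2 ^ (m - i.+1))].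

Lemma rhoE m (j : 'I_(2 ^ m)) i : rho j i = (i \in supp j)%:R.
Proof. by rewrite inE. Qed.

(** The quotients by [2 ^ (m - k)] record the [k] leading bits. The least [k] at which they differ
    locates the first differing bit, and the order of the quotients tells which of the two bits is
    1. *)
Lemma lt_first_bit m (j j' : 'I_(2 ^ m)) : (j < j')%N ->
  exists i : 'I_m, [/\ forall k : 'I_m, (k < i)%N -> (k \in supp j) = (k \in supp j'),
                       i \notin supp j & i \in supp j'].
Proof.
move=> lt_jj'.
pose P (k : nat) := (j %/ 2 ^ (m - k) != j' %/ 2 ^ (m - k))%N.
have exP : exists k, P k by exists m; rewrite /P subnn !divn1 neq_ltn lt_jj'.
case: (ex_minnP exP) => -[|k].
  by rewrite /P subn0 !divn_small ?ltn_ord.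
move=> Pk minP.
have lt_km : (k < m)%N.
  rewrite ltnNge; apply/negP => le_mk; have := minP k.
  rewrite /P (eqP (_ : m - k == 0)%N) // divn1 divn1 => /(_ _).
  by rewrite neq_ltn lt_jj' ltnn => /(_ isT).
have split_pow : (2 ^ (m - k) = 2 ^ (m - k.+1) * 2)%N.
  by rewrite -expnSr; congr (2 ^ _)%N; lia.
have eq_k : (j %/ 2 ^ (m - k) = j' %/ 2 ^ (m - k))%N.
  by apply/eqP; apply: contraT => /minP; rewrite ltnn.
have le_k : (j %/ 2 ^ (m - k.+1) <= j' %/ 2 ^ (m - k.+1))%N.
  by rewrite leq_div2r // ltnW.
rewrite split_pow !divnMA in eq_k; move: Pk; rewrite /P.
exists (Ordinal lt_km); split.
- move=> i /= lt_ik; rewrite !inE.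
  suff -> : (j %/ 2 ^ (m - i.+1) = j' %/ 2 ^ (m - i.+1))%N by [].
  by apply/eqP; apply: contraT => /minP; rewrite leqNgt ltnS lt_ik.
- by rewrite inE /=; move: Pk eq_k le_k; lia.
- by rewrite inE /=; move: Pk eq_k le_k; lia.
Qed.

Lemma supp_inj m : injective (@supp m).
Proof.
move=> j j' eq_s.
case: (ltngtP j j') => [lt_j|lt_j|/val_inj //]; exfalso;
  case: (lt_first_bit lt_j) => i [_ /negP ni yi]; apply: ni; rewrite ?eq_s //.
by rewrite -eq_s.
Qed.

Lemma lt_supp m (j j' : 'I_(2 ^ m)) (i : 'I_m) :
  (forall k : 'I_m, (k < i)%N -> (k \in supp j) = (k \in supp j')) ->
  i \notin supp j -> i \in supp j' -> (j < j')%N.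
Proof.
move=> eq_lt nij ij'; rewrite ltnNge; apply/negP; rewrite leq_eqVlt => /orP[/eqP eqj|].
  by move: nij; rewrite -(val_inj eqj) ij'.
move=> /lt_first_bit [k [eq_k nkj' kj]].
case: (ltngtP k i) => [lt_ki|lt_ik|/val_inj eq_ki].
- by move: nkj'; rewrite -eq_lt // kj.
- by move: nij; rewrite -eq_k // ij'.
- by move: nkj'; rewrite eq_ki ij'.
Qed.

Lemma supp_bij m : bijective (@supp m).
Proof.
apply: inj_card_bij; first exact: supp_inj.
by rewrite card_ord -cardsT -powersetT card_powerset cardsT card_ord.
Qed.


(** Moebius inversion on the Boolean lattice, modulo 2: a nonempty interval has [2 ^ #|T :\: R|]
    elements, an odd number only when [R = T]. *)
Lemma sum_interval (I : finType) (R T : {set I}) :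
  \sum_(S : {set I} | (R \subset S) && (S \subset T)) 1 = (R == T)%:R :> 'F_2.
Proof.
case: (boolP (R \subset T)) => [RT|nRT]; last first.
  rewrite big1; first by case: eqP nRT => // ->; rewrite subxx.
  by move=> S /andP[RS ST]; move: nRT; rewrite (subset_trans RS ST).
rewrite sumr_const [LHS]F2_natr_odd; set A := (X in odd #|X|).
suff -> : odd #|A| = (R == T) by [].
pose F := [set R :|: B | B in powerset (T :\: R)].
have -> : #|A| = #|F|.
  apply: eq_card => S; rewrite unfold_in; apply/andP/imsetP => [[RS ST]|[B]].
    exists (S :\: R); first by rewrite powersetE setSD.
    by rewrite setDE setUIr setUCr setIT; apply/esym/setUidPr.
  by rewrite powersetE subsetD => /andP[BT _] ->; rewrite subsetUl subUset RT BT.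
rewrite card_in_imset; last first.
  move=> B B'; rewrite !powersetE !subsetD => /andP[_ dB] /andP[_ dB'] /(congr1 (fun X => X :\: R)).
  by rewrite !setDUl setDv !set0U !(setDidPl _).
by rewrite card_powerset oddX /= orbF cards_eq0 setD_eq0 eqEsubset RT.
Qed.

(** * Algebraic normal form and Reed-Muller codes *)

Definition mono m (S : {set 'I_m}) : word (2 ^ m) := \row_j (S \subset supp j)%:R.

(* the coefficient of x_S in the algebraic normal form of y *)
Definition anf m (y : word (2 ^ m)) (S : {set 'I_m}) : 'F_2 :=
  \sum_(j | supp j \subset S) y 0 j.

Lemma anfD m (x y : word (2 ^ m)) S : anf (x + y) S = anf x S + anf y S.
Proof. by rewrite /anf -big_split; apply: eq_bigr => j _; rewrite !mxE. Qed.

Lemma anf0 m (S : {set 'I_m}) : anf 0 S = 0.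
Proof. by rewrite /anf big1 // => j _; rewrite mxE. Qed.

Lemma anfZ m a (y : word (2 ^ m)) S : anf (a *: y) S = a * anf y S.
Proof. by rewrite /anf mulr_sumr; apply: eq_bigr => j _; rewrite mxE. Qed.

Lemma anf_sum m (I : Type) (r : seq I) (P : pred I) (F : I -> word (2 ^ m)) S :
  anf (\sum_(i <- r | P i) F i) S = \sum_(i <- r | P i) anf (F i) S.
Proof.
by rewrite (big_morph (fun y => anf y S) (fun x y => anfD x y S) (anf0 S)).
Qed.

(** Exchanging the sums leaves, for each [k], the parity of the interval between [supp k] and
    [supp j], so that only [k = j] survives. *)
Lemma anfK m (y : word (2 ^ m)) j : \sum_(S : {set 'I_m} | S \subset supp j) anf y S = y 0 j.
Proof.
rewrite (exchange_big_dep xpredT) //=.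
under eq_bigr => k _.
  rewrite (eq_bigr (fun=> y 0 k * 1)) => [|S _]; last by rewrite mulr1.
  rewrite -mulr_sumr.
  rewrite (eq_bigl (fun S : {set _} => (supp k \subset S) && (S \subset supp j))); last first.
    by move=> S; rewrite andbC.
  rewrite sum_interval (inj_eq (@supp_inj m)).
  over.
rewrite (bigD1 j) //= eqxx mulr1 big1 ?addr0 // => k /negbTE ->.
by rewrite mulr0.
Qed.

Lemma anf_mono m (A S : {set 'I_m}) : anf (mono A) S = (A == S)%:R.
Proof.
rewrite /anf -sum_interval (reindex (@supp m)) /=; last exact/onW_bij/supp_bij.
rewrite big_mkcond [RHS]big_mkcond; apply: eq_bigr => j _; rewrite mxE.
by case: (supp j \subset S); case: (A \subset supp j).
Qed.

Lemma mono_word_inj m : injective (@mono m).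
Proof.
move=> A B /(congr1 (fun y => anf y B)); rewrite !anf_mono eqxx.
by case: eqP => // _ /eqP; rewrite eq_sym oner_eq0.
Qed.

(** Over F_2 all positive powers of a variable agree as functions, so only the set of occurring
    variables matters. *)
Lemma Eval_monomial m (mon : 'X_{1..m}) : Eval 'X_[mon] = mono [set i | mon i != 0%N].
Proof.
apply/rowP => j; rewrite !mxE mevalX.
case: (boolP (_ \subset _)) => [/subsetP sub|/subsetPn [i]].
  rewrite big1 // => i _; rewrite rhoE; case: (boolP (mon i == 0%N)) => [/eqP->//|ni].
  by rewrite (sub i) ?inE // expr1n.
rewrite inE => ni nsi; rewrite (bigD1 i) //= rhoE (negbTE nsi) expr0n (negbTE ni).
by rewrite mul0r.
Qed.

Definition set_mnm m (S : {set 'I_m}) : 'X_{1..m} := [multinom (i \in S : nat) | i < m].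

Lemma mdeg_set_mnm m (S : {set 'I_m}) : mdeg (set_mnm S) = #|S|.
Proof.
rewrite mdegE -sum1_card [RHS]big_mkcond /=; apply: eq_bigr => i _.
by rewrite mnmE; case: (i \in S).
Qed.

Lemma mono_Eval m (S : {set 'I_m}) : mono S = Eval 'X_[set_mnm S].
Proof.
rewrite Eval_monomial; congr mono; apply/setP => i.
by rewrite !inE mnmE; case: (i \in S).
Qed.

Lemma card_mnm_supp m (mon : 'X_{1..m}) : (#|[set i | mon i != 0%N]| <= mdeg mon)%N.
Proof.
rewrite mdegE -sum1_card big_mkcond /=; apply: leq_sum => i _.
by rewrite inE; case: (mon i).
Qed.

(** Replacing each monomial of [f] by its squarefree part does not raise the degree. *)
Lemma Eval_anf m r (w : word (2 ^ m)) (S : {set 'I_m}) :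
  w \in RM r m -> r < #|S|%:Z -> anf w S = 0.
Proof.
rewrite inE => /asboolP[f df ->] ltS.
have -> : Eval f = \sum_(mon <- msupp f) f@_mon *: mono [set i | mon i != 0%N].
  apply/rowP => j; rewrite summxE mxE mevalE; apply: eq_bigr => mon _.
  by rewrite mxE -Eval_monomial mxE mevalX.
rewrite anf_sum big_seq big1 // => mon /df le_r.
rewrite anfZ anf_mono; case: eqP => [eqS|_]; last by rewrite mulr0.
exfalso; move: (card_mnm_supp mon); rewrite eqS; move: ltS le_r; card_lia.
Qed.

Lemma mono_RM m r (S : {set 'I_m}) : #|S|%:Z <= r -> mono S \in RM r m.
Proof.
move=> le_r; rewrite inE; apply/asboolP; exists 'X_[set_mnm S]; last exact: mono_Eval.
by move=> mon; rewrite msuppX inE => /eqP ->; rewrite mdeg_set_mnm.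
Qed.

Lemma RM0 m r : 0 \in RM r m.
Proof.
rewrite inE; apply/asboolP; exists 0; first by move=> mon; rewrite msupp0.
by apply/rowP => j; rewrite !mxE meval0.
Qed.

Lemma RMD m r x y : x \in RM r m -> y \in RM r m -> x + y \in RM r m.
Proof.
rewrite !inE => /asboolP[f df ->] /asboolP[g dg ->]; apply/asboolP; exists (f + g).
  by move=> mon /msuppD_le; rewrite mem_cat => /orP[/df|/dg].
by apply/rowP => j; rewrite !mxE mevalD.
Qed.

Lemma RM_sum m r (I : Type) (s : seq I) (P : pred I) (F : I -> word (2 ^ m)) :
  (forall i, P i -> F i \in RM r m) -> \sum_(i <- s | P i) F i \in RM r m.
Proof. by move=> RMF; elim/big_ind: _ => //; [exact: RM0 | exact: RMD]. Qed.

(* [supp j \subset T] is the value at [j] of the product of the 1 + x_i, i \notin T. *)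
Lemma subset_word_RM m r (T : {set 'I_m}) : (m <= #|T| + r)%N ->
  \row_j (supp j \subset T)%:R \in RM r%:Z m.
Proof.
move=> le_m.
suff -> : \row_j (supp j \subset T)%:R = \sum_(B : {set 'I_m} | B \subset ~: T) mono B.
  apply: RM_sum => B /subset_leq_card le_B; apply: mono_RM.
  by move: (cardsC T) le_B; rewrite card_ord; card_lia.
apply/rowP => j; rewrite !mxE summxE.
transitivity ((set0 == ~: T :&: supp j)%:R : 'F_2).
  by rewrite eq_sym setIC -setDE setD_eq0.
rewrite -sum_interval big_mkcond [RHS]big_mkcond /=; apply: eq_bigr => B _.
by rewrite sub0set subsetI mxE; case: (B \subset ~: T); case: (B \subset supp j).
Qed.

(** The left side is the inner product of [y] with x_A. On the right, [y 0 j] is counted once per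
    subset of [A :\: supp j], an odd number of times only if [A \subset supp j]. *)
Lemma sum_superset m (y : word (2 ^ m)) (A : {set 'I_m}) :
  \sum_(j | A \subset supp j) y 0 j = \sum_(B : {set 'I_m} | B \subset A) anf y (~: B).
Proof.
rewrite (exchange_big_dep xpredT) //= big_mkcond /=; apply: eq_bigr => j _.
rewrite (eq_bigr (fun=> y 0 j * 1)) => [|B _]; last by rewrite mulr1.
rewrite -mulr_sumr.
rewrite (eq_bigl (fun B : {set _} => (set0 \subset B) && (B \subset A :\: supp j))); last first.
  by move=> B; rewrite sub0set subsetD disjoints_subset subsetC.
rewrite sum_interval eq_sym setD_eq0.
by case: ifP; rewrite ?mulr1 ?mulr0.
Qed.

(** Pairing [y] with the product of the 1 + x_i, i outside [S], of degree m - |S| <= r, reads off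
    [anf y S]. Conversely, pairing with x_A for |A| <= r only involves coefficients at sets of size
    at least m - r. *)
Lemma dual_RM r m (y : word (2 ^ m)) :
  y \in dual_code (RM r%:Z m) <->
  forall S : {set 'I_m}, (m <= #|S| + r)%N -> anf y S = 0.
Proof.
rewrite inE; split=> [/forall_inP dy S leS|anf_y].
  have /eqP/matrixP/(_ 0 0) := dy _ (subset_word_RM leS).
  rewrite !mxE => <-; rewrite /anf big_mkcond; apply: eq_bigr => j _.
  by rewrite !mxE; case: (_ \subset _); rewrite ?mul1r ?mul0r.
apply/forall_inP => w RMw; apply/eqP/matrixP => i k; rewrite !ord1 !mxE {i k}.
have -> : \sum_j w 0 j * y^T j 0 =
    \sum_(A : {set 'I_m}) anf w A * \sum_(j | A \subset supp j) y 0 j.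
  under [RHS]eq_bigr => A _ do rewrite mulr_sumr.
  rewrite [RHS](exchange_big_dep xpredT) //=; apply: eq_bigr => j _.
  by rewrite -mulr_suml anfK mxE.
rewrite big1 // => A _; case: (leqP #|A| r) => [leA|ltA].
  rewrite sum_superset big1 ?mulr0 // => B /subset_leq_card leB; apply: anf_y.
  by move: (cardsC B); rewrite card_ord; card_lia.
by rewrite (Eval_anf RMw) ?mul0r.
Qed.

(** * Splitting off the first variable *)

(** A set of variables other than x_1, renumbered, with x_1 added when [b] holds. As x_1 is the most
    significant bit, it separates the two halves of a word. *)
Definition up m (b : bool) (u : {set 'I_m}) : {set 'I_m.+1} :=
  [set i | if unlift ord0 i is Some k then k \in u else b].

Lemma in_up0 m b (u : {set 'I_m}) : (ord0 \in up b u) = b.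
Proof. by rewrite inE unlift_none. Qed.

Lemma in_upS m b (u : {set 'I_m}) k : (lift ord0 k \in up b u) = (k \in u).
Proof. by rewrite inE liftK. Qed.

Lemma up_ext m b (u : {set 'I_m}) (S : {set 'I_m.+1}) :
  (ord0 \in S) = b -> (forall k, (lift ord0 k \in S) = (k \in u)) -> S = up b u.
Proof.
move=> S0 SS; apply/setP => i; case: (unliftP ord0 i) => [k ->|->].
  by rewrite in_upS SS.
by rewrite in_up0 S0.
Qed.

Lemma up_surj m (S : {set 'I_m.+1}) : exists b u, S = up b u.
Proof.
exists (ord0 \in S), [set k | lift ord0 k \in S].
by apply: up_ext => // k; rewrite inE.
Qed.

Lemma subset_up m a b (u v : {set 'I_m}) :
  (up a u \subset up b v) = (a ==> b) && (u \subset v).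
Proof.
apply/subsetP/andP => [sub|[/implyP ab /subsetP uv] i].
  split; first by apply/implyP; rewrite -(in_up0 a u) => /sub; rewrite in_up0.
  by apply/subsetP => k; rewrite -(in_upS a) => /sub; rewrite in_upS.
case: (unliftP ord0 i) => [k ->|->]; first by rewrite !in_upS => /uv.
by rewrite !in_up0.
Qed.

Lemma card_up m b (u : {set 'I_m}) : #|up b u| = (b + #|u|)%N.
Proof.
rewrite -sum1_card big_mkcond big_ord_recl /= in_up0.
rewrite -[#|u|]sum1_card [X in (_ = _ + X)%N]big_mkcond.
congr (_ + _)%N.
by apply: eq_bigr => k _; rewrite in_upS.
Qed.

Lemma up_inj m b b' (u u' : {set 'I_m}) : up b u = up b' u' -> b = b' /\ u = u'.
Proof.
move=> eq_up; split; first by rewrite -(in_up0 b u) eq_up in_up0.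
by apply/setP => k; rewrite -(in_upS b) eq_up in_upS.
Qed.

Lemma supp_lo m (j : 'I_(2 ^ m)) : supp (lo j) = up false (supp j).
Proof.
apply: up_ext => [|k]; rewrite !inE /=.
  by rewrite subSS subn0 divn_small.
by rewrite /bump leq0n add1n subSS.
Qed.

Lemma supp_hi m (j : 'I_(2 ^ m)) : supp (hi j) = up true (supp j).
Proof.
apply: up_ext => [|k]; rewrite !inE /=.
  by rewrite subSS subn0 divnDl // divnn pow2_gt0 divn_small.
rewrite /bump leq0n add1n subSS.
(* The offset [2 ^ m] adds the even number [2 ^ k.+1] to the quotient, so these bits do not
   change. *)
have split_pow : (2 ^ m = 2 ^ k.+1 * 2 ^ (m - k.+1))%N by rewrite -expnD subnKC.
by rewrite [X in (X + _)%N]split_pow divnMDl ?pow2_gt0 // oddD oddX.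
Qed.

Lemma lo_hi_cases m (j : 'I_(2 ^ m.+1)) : (exists k, j = lo k) \/ (exists k, j = hi k).
Proof.
rewrite -(cast_ordKV (double_pow2 m) j).
by case: (split_ordP (cast_ord (esym (double_pow2 m)) j)) => k ->; [left | right]; exists k.
Qed.

Lemma big_lo_hi (R : Type) (idx : R) (op : Monoid.com_law idx) m (F : 'I_(2 ^ m.+1) -> R) :
  \big[op/idx]_j F j = op (\big[op/idx]_j F (lo j)) (\big[op/idx]_j F (hi j)).
Proof.
rewrite (reindex (cast_ord (double_pow2 m))) /=; last first.
  by exists (cast_ord (esym (double_pow2 m))) => k _; rewrite ?cast_ordK ?cast_ordKV.
by rewrite big_split_ord.
Qed.

Lemma lo_neq_hi m (j k : 'I_(2 ^ m)) : lo j != hi k.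
Proof.
by apply/eqP => /(congr1 (@supp _)); rewrite supp_lo supp_hi => /up_inj[].
Qed.

Lemma lo_inj m : injective (@lo m).
Proof. by move=> j k /cast_ord_inj/lshift_inj. Qed.

Lemma hi_inj m : injective (@hi m).
Proof. by move=> j k /cast_ord_inj/rshift_inj. Qed.

Lemma word_lo_hi m (x y : word (2 ^ m.+1)) :
  lo_word x = lo_word y -> hi_word x = hi_word y -> x = y.
Proof.
move=> /rowP eq_lo /rowP eq_hi; apply/rowP => j.
by case: (lo_hi_cases j) => -[k ->]; [move: (eq_lo k) | move: (eq_hi k)]; rewrite !mxE.
Qed.

Lemma lo_wpair m (u v : word (2 ^ m)) : lo_word (wpair u v) = u.
Proof. by apply/rowP => j; rewrite !mxE castmxE /= cast_ordK row_mxEl ord1. Qed.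

Lemma hi_wpair m (u v : word (2 ^ m)) : hi_word (wpair u v) = v.
Proof. by apply/rowP => j; rewrite !mxE castmxE /= cast_ordK row_mxEr ord1. Qed.

(** This is the decomposition f = f(0, .) + x_1 (f(0, .) + f(1, .)). *)
Lemma anf_up m (y : word (2 ^ m.+1)) b u :
  anf y (up b u) = anf (lo_word y) u + b%:R * anf (hi_word y) u.
Proof.
rewrite /anf big_mkcond big_lo_hi /=; congr (_ + _).
  rewrite [RHS]big_mkcond; apply: eq_bigr => j _.
  by rewrite supp_lo subset_up mxE.
rewrite mulr_sumr [RHS]big_mkcond; apply: eq_bigr => j _.
by rewrite supp_hi subset_up mxE; case: b; rewrite ?mul1r ?mul0r //= if_same.
Qed.

Lemma mono_up0 m (u : {set 'I_m}) : wpair (mono u) (mono u) = mono (up false u).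
Proof.
apply: word_lo_hi; rewrite ?lo_wpair ?hi_wpair; apply/rowP => j;
  by rewrite !mxE ?supp_lo ?supp_hi subset_up.
Qed.

Lemma mono_up1 m (u : {set 'I_m}) : wpair 0 (mono u) = mono (up true u).
Proof.
apply: word_lo_hi; rewrite ?lo_wpair ?hi_wpair; apply/rowP => j;
  by rewrite !mxE ?supp_lo ?supp_hi subset_up.
Qed.

(** Used to identify the first Hadamard index [k], a sum of binomials, with a number of rows. *)
Lemma card_sets_sum n a b :
  #|[set S : {set 'I_n} | a <= #|S| < b]%N| = (\sum_(a <= i < b) 'C(n, i))%N.
Proof.
transitivity (\sum_(a <= i < b) #|[set S : {set 'I_n} | #|S| == i]|)%N; last first.
  by apply: eq_bigr => i _; rewrite card_draws card_ord.
under eq_bigr => i _.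
  rewrite -sum1_card (eq_bigl (fun S : {set 'I_n} => #|S| == i)) ?big_mkcond => [|S]; last first.
    by rewrite inE.
  over.
rewrite exchange_big -sum1_card big_mkcond /=; apply: eq_bigr => S _; rewrite inE.
rewrite -big_mkcond -(mem_index_iota) sum1_count /=.
have -> : count (fun i => #|S| == i) (index_iota a b) = count_mem #|S| (index_iota a b).
  by apply: eq_count => i; rewrite eq_sym.
by rewrite count_uniq_mem ?iota_uniq //; case: (_ \in _).
Qed.

(** * Rows of the matrices G(r, m) *)

Section MonomialRows.
Variable G : int -> forall m, seq (word (2 ^ m)).
Hypothesis hG : monomial_rows G.

Lemma mem_G r m v : v \in G r m <-> exists2 S : {set 'I_m}, #|S|%:Z <= r & v = mono S.
Proof.
case: (hG r m) => _ ->; split=> [[mon le_r ->]|[S le_r ->]].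
  exists [set i | mon i != 0%N]; last exact: Eval_monomial.
  by apply: le_trans le_r; rewrite lez_nat card_mnm_supp.
by exists (set_mnm S); rewrite ?mdeg_set_mnm // mono_Eval.
Qed.

Lemma mono_in_G r m (S : {set 'I_m}) : (mono S \in G r m) = (#|S|%:Z <= r).
Proof.
apply/idP/idP => [/mem_G[T le_r /mono_word_inj->]//|le_r].
by apply/mem_G; exists S.
Qed.

Lemma mem_rows_diff r d m v : v \in rows_diff (G r m) (G d m) <->
  exists2 S : {set 'I_m}, d < #|S|%:Z <= r & v = mono S.
Proof.
rewrite mem_filter; split=> [/andP[nd /mem_G[S le_r eqv]]|[S /andP[lt_d le_r] ->]].
  by exists S => //; rewrite le_r andbT; move: nd; rewrite eqv mono_in_G -ltNge.
by rewrite !mono_in_G -ltNge lt_d.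
Qed.

Lemma rows_diff_uniq r d m : uniq (rows_diff (G r m) (G d m)).
Proof. by rewrite filter_uniq //; case: (hG r m). Qed.

Lemma size_rows_diff r d m :
  size (rows_diff (G r m) (G d m)) = #|[set S : {set 'I_m} | d < #|S|%:Z <= r]|.
Proof.
rewrite cardE -(size_map (@mono m)); apply/perm_size/uniq_perm.
- exact: rows_diff_uniq.
- by rewrite map_inj_uniq ?enum_uniq //; exact: mono_word_inj.
move=> v; apply/idP/mapP => [/mem_rows_diff[S PS ->]|[S]].
  by exists S => //; rewrite mem_enum inE.
by rewrite mem_enum inE => PS ->; apply/mem_rows_diff; exists S.
Qed.

End MonomialRows.

(** There are only [2 ^ m] squarefree monomials; this keeps [index_map] away from its default
    value. *)
Lemma size_monos m (M : seq (word (2 ^ m))) :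
  uniq M -> {subset M <= codom (@mono m)} -> (size M <= 2 ^ m)%N.
Proof.
move=> uM sub; apply: leq_trans (uniq_leq_size uM sub) _.
by rewrite size_codom -cardsT -powersetT card_powerset cardsT card_ord.
Qed.

Lemma index_mapE m (M : seq (word (2 ^ m))) v :
  uniq M -> {subset M <= codom (@mono m)} -> v \in M -> Defs.index_map M v = index v M :> nat.
Proof.
move=> uM sub vM; rewrite /Defs.index_map val_insubd.
by rewrite (leq_trans _ (size_monos uM sub)) // index_mem.
Qed.

(** * Gates *)

Lemma sum_F2 (V : nmodType) (F : 'F_2 -> V) : \sum_b F b = F 0 + F 1.
Proof.
rewrite big_ord_recl big_ord1; congr (F _ + F _); exact: val_inj.
Qed.

Definition set_bit n (x : word n) (i : 'I_n) (b : 'F_2) : word n :=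
  \row_j (if j == i then b else x 0 j).

Lemma set_bit_in n (x : word n) i b : set_bit x i b 0 i = b.
Proof. by rewrite mxE eqxx. Qed.

Lemma set_bit_out n (x : word n) i b j : j != i -> set_bit x i b 0 j = x 0 j.
Proof. by move=> /negbTE ji; rewrite mxE ji. Qed.

Definition eq_off n (L : pred 'I_n) (y x : word n) : bool :=
  [forall (j | ~~ L j), y 0 j == x 0 j].

Lemma eq_offP n (L : pred 'I_n) (y x : word n) :
  reflect (forall j, ~~ L j -> y 0 j = x 0 j) (eq_off L y x).
Proof.
by apply: (iffP forall_inP) => eq_yx j nj; apply/eqP; [exact: eq_yx | rewrite eq_yx].
Qed.

Section Operators.
Variable C : numClosedFieldType.
Implicit Types n m : nat.

Lemma sum_set_bit n (x : word n) i (F : word n -> C) :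
  \sum_(z : word n) ([forall (j | j != i), z 0 j == x 0 j])%:R * F z = \sum_b F (set_bit x i b).
Proof.
transitivity (\sum_(z : word n | [forall (j | j != i), z 0 j == x 0 j]) F z).
  by rewrite [RHS]big_mkcond; apply: eq_bigr => z _; case: ifP; rewrite ?mul1r ?mul0r.
have setP b : [forall (j | j != i), set_bit x i b 0 j == x 0 j].
  by apply/forall_inP => j ji; rewrite set_bit_out.
rewrite (reindex (set_bit x i)); first by apply: eq_bigl => b; rewrite setP.
exists (fun z : word n => z 0 i) => [b _|z]; first by rewrite set_bit_in.
rewrite inE => /forall_inP eq_zx; apply/rowP => j; rewrite mxE.
by case: eqP => [->//|/eqP/eq_zx/eqP->].
Qed.

(** The columns are orthonormal, so the adjoint is a left inverse: this is what makes [adjoint U] a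
    decoder. *)
Definition isometric n (A : qop C n) : Prop :=
  forall x y, \sum_z (A z x)^* * A z y = (x == y)%:R.

Lemma conj_bool (b : bool) : (b%:R : C)^* = b%:R.
Proof. by rewrite conjC_nat. Qed.

Lemma sum_pred1 (T : finType) (x : T) (F : T -> C) : \sum_z (z == x)%:R * F z = F x.
Proof.
rewrite (bigD1 x) //= eqxx mul1r big1 ?addr0 // => z /negbTE ->.
by rewrite mul0r.
Qed.

Lemma prodr_bool (I : finType) (P : pred I) : \prod_i (P i)%:R = [forall i, P i]%:R :> C.
Proof.
case: (boolP [forall i, _]) => [/forallP Pi|]; first by rewrite big1 // => i _; rewrite Pi.
by rewrite negb_forall => /existsP[i /negbTE nPi]; rewrite (bigD1 i) //= nPi mul0r.
Qed.

Lemma isometric_graph n (A : qop C n) (f : word n -> word n) :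
  injective f -> (forall y x, A y x = (y == f x)%:R) -> isometric A.
Proof.
move=> f_inj AE x y; under eq_bigr => z _ do rewrite !AE conj_bool.
by rewrite sum_pred1 inj_eq.
Qed.

Lemma isometric_id n : isometric (@id_op C n).
Proof. exact: (isometric_graph (f := id)). Qed.

Lemma isometric_then n (A B : qop C n) : isometric A -> isometric B -> isometric (then_op A B).
Proof.
move=> isoA isoB x y; rewrite /then_op -(isoA x y).
transitivity (\sum_a \sum_b (A a x)^* * A b y * \sum_z (B z a)^* * B z b).
  under eq_bigr => z _ do rewrite rmorph_sum mulr_suml.
  rewrite exchange_big; apply: eq_bigr => a _.
  under eq_bigr => z _ do rewrite mulr_sumr.
  rewrite exchange_big; apply: eq_bigr => b _; rewrite mulr_sumr; apply: eq_bigr => z _.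
  by rewrite rmorphM mulrACA [LHS]mulrC.
apply: eq_bigr => a _; under eq_bigr => b _ do rewrite isoB eq_sym mulrC.
by rewrite sum_pred1.
Qed.

Lemma circuit_map_isometric n (T : Type) (F : T -> qop C n) (s : seq T) :
  (forall t, isometric (F t)) -> isometric (circuit (map F s)).
Proof.
by move=> isoF; elim: s => [|t s IH]; [exact: isometric_id | exact: isometric_then].
Qed.

Lemma then_graph n (A B : qop C n) (f : word n -> word n) :
  (forall y x, A y x = (y == f x)%:R) -> forall z x, then_op A B z x = B z (f x).
Proof.
move=> AE z x; rewrite /then_op; under eq_bigr => y _ do rewrite AE mulrC.
by rewrite sum_pred1.
Qed.

Lemma then_id n (A : qop C n) z x : then_op A id_op z x = A z x.
Proof.
rewrite /then_op /id_op; under eq_bigr => y _ do rewrite eq_sym.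
by rewrite sum_pred1.
Qed.

Lemma sqrt2_neq0 : sqrtC (2%:R : C) != 0.
Proof. by rewrite sqrtC_eq0 pnatr_eq0. Qed.

Lemma sqrt2_inv_sq : ((sqrtC (2%:R : C))^-1) ^+ 2 *+ 2 = 1.
Proof. by rewrite exprVn sqrtCK -mulr_natr mulVf // pnatr_eq0. Qed.

(** Summing over bit [i] of [z] gives 1 + (-1)^(x_i + y_i), which vanishes unless the two bits
    agree. *)
Lemma isometric_hadamard n (i : 'I_n) : isometric (@hadamard C n i).
Proof.
move=> x y; set s : C := (sqrtC 2%:R)^-1.
have s_conj : s^* = s.
  by apply: geC0_conj; rewrite invr_ge0 sqrtC_ge0 ler0n.
transitivity (\sum_(z : word n) ([forall (j | j != i), z 0 j == x 0 j])%:R *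
  (([forall (j | j != i), z 0 j == y 0 j])%:R *
   (s ^+ 2 * ((-1) ^+ (x 0%R i * z 0%R i)%N * (-1) ^+ (y 0%R i * z 0%R i)%N)))).
  apply: eq_bigr => z _; rewrite /hadamard !rmorphM /= conj_bool s_conj rmorphXn rmorphN1.
  by rewrite expr2 mulrACA [X in _ * X]mulrACA -[LHS]mulrA.
rewrite sum_set_bit sum_F2 !set_bit_in !muln0 !mulr1.
have eqE b : [forall (j | j != i), set_bit x i b 0 j == y 0 j] =
             [forall (j | j != i), x 0 j == y 0 j].
  by apply: eq_forallb_in => j ji; rewrite set_bit_out.
rewrite !eqE; case: (boolP [forall (j | j != i), x 0 j == y 0 j]) =>
  [/forall_inP eq_xy|/forall_inPn [j ji neq]]; last first.
  by rewrite !mul0r addr0; case: (x =P y) neq => // ->; rewrite eqxx.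
rewrite !mul1r -exprD.
have -> : (x == y) = (x 0 i == y 0 i).
  apply/eqP/eqP => [->//|eq_i]; apply/rowP => j.
  by case: (eqVneq j i) => [->//|/eq_xy/eqP].
case: (F2_cases (x 0 i)) (F2_cases (y 0 i)) => -> [] -> /=;
  rewrite ?mulr1 ?expr1 ?expr2 ?mulrN1 ?subrr ?mulrNN ?mulr1 -?mulr2n ?sqrt2_inv_sq //.
by rewrite opprK mulr1 -mulr2n -expr2 sqrt2_inv_sq.
Qed.

Lemma hadamard_zero n (i : 'I_n) (x y : word n) : x 0 i = 0 ->
  hadamard C i y x = ([forall (j | j != i), y 0 j == x 0 j])%:R * (sqrtC (2%:R : C))^-1.
Proof. by move=> xi; rewrite /hadamard xi mul0n expr0 mulr1. Qed.

(** On a bit equal to 0 the Hadamard sign is trivial, so the layer spreads [x] uniformly over all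
    values of the bits in [L]. *)
Lemma circuit_hadamard n (L : seq 'I_n) (x y : word n) :
  uniq L -> (forall i, i \in L -> x 0 i = 0) ->
  circuit [seq @hadamard C n i | i <- L] y x =
  (sqrtC 2%:R)^-1 ^+ size L * (eq_off (mem L) y x)%:R.
Proof.
elim: L x => [|i L IH] x /= => [_ _|/andP[niL uL] xL].
  rewrite /id_op expr0 mul1r; congr (nat_of_bool _)%:R.
  by apply/eqP/eq_offP => [-> //|eq_yx]; apply/rowP => j; apply: eq_yx.
rewrite /then_op.
under eq_bigr => z _ do rewrite hadamard_zero ?xL ?mem_head // mulrCA.
rewrite sum_set_bit.
have zL b j : j \in L -> set_bit x i b 0 j = 0.
  move=> jL; rewrite set_bit_out ?xL ?inE ?jL ?orbT //.
  by apply: contraNneq niL => <-.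
(* Bit [i] of [y] singles out the one value [b] that leads to [y]. *)
have eqE b : eq_off (mem L) y (set_bit x i b) = eq_off (mem (i :: L)) y x && (b == y 0 i).
  apply/eq_offP/andP => [eq_yb|[/eq_offP eq_yx /eqP ->] j njL].
    split; last by rewrite eq_yb // set_bit_in.
    apply/eq_offP => j /=; rewrite inE negb_or => /andP[ji njL].
    by rewrite eq_yb // set_bit_out.
  case: (eqVneq j i) => [->|ji]; first by rewrite set_bit_in.
  by rewrite set_bit_out // eq_yx //= inE negb_or ji.
under eq_bigr => b _ do rewrite (IH _ uL (zL b)) eqE.
rewrite -mulr_suml -mulr_sumr exprSr mulrAC; congr (_ * _).
case: eq_off => /=; last by rewrite big1.
by rewrite (bigD1 (y 0 i)) //= eqxx big1 ?addr0 // => b /negbTE ->.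
Qed.

Definition perm_word n (p : {perm 'I_n}) (x : word n) : word n :=
  \row_j x 0 ((p^-1)%g j).

Lemma perm_opE n (p : {perm 'I_n}) (y x : word n) :
  perm_op C p y x = (y == perm_word p x)%:R.
Proof.
congr (nat_of_bool _)%:R; apply/forallP/eqP => [eq_yx|-> i]; last by rewrite mxE permK.
by apply/rowP => j; rewrite mxE -(eqP (eq_yx _)) permKV.
Qed.

Lemma perm_word_inj n (p : {perm 'I_n}) : injective (perm_word p).
Proof.
by move=> x y /rowP eq_xy; apply/rowP => j; move: (eq_xy (p j)); rewrite !mxE permK.
Qed.

Lemma isometric_perm n (p : {perm 'I_n}) : isometric (perm_op C p).
Proof. exact: isometric_graph (@perm_word_inj n p) (perm_opE p). Qed.

Lemma isometric_cnot n (i j : 'I_n) : i != j -> isometric (cnot C i j).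
Proof.
move=> ij; apply: (@isometric_graph _ _ (fun x : word n => x + x 0 i *: delta_mx 0 j)) => // x y.
move=> eq_xy; have eq_i : x 0 i = y 0 i.
  by move/rowP/(_ i): eq_xy; rewrite !mxE (negbTE ij) !andbF !mulr0 !addr0.
by move: eq_xy; rewrite eq_i => /addIr.
Qed.

Definition cnot_word m (L : seq 'I_(2 ^ m)) (x : word (2 ^ m.+1)) : word (2 ^ m.+1) :=
  wpair (lo_word x) (\row_j (x 0 (hi j) + (j \in L)%:R * x 0 (lo j))).

(** All controls lie in the first half and all targets in the second, so the gates do not disturb
    each other; by [uniq L] each target receives its control once. *)
Lemma circuit_cnot m (L : seq 'I_(2 ^ m)) (y x : word (2 ^ m.+1)) : uniq L ->
  circuit [seq cnot C (lo j) (hi j) | j <- L] y x = (y == cnot_word L x)%:R.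
Proof.
elim: L x => [|j L IH] x /= => [_|/andP[njL uL]].
  congr (nat_of_bool (_ == _))%:R; apply: word_lo_hi; rewrite ?lo_wpair ?hi_wpair //.
  by apply/rowP => k; rewrite !mxE mul0r addr0.
rewrite (then_graph _ (f := fun z => z + z 0 (lo j) *: delta_mx 0 (hi j))) // IH //.
congr (nat_of_bool (_ == _))%:R; rewrite /cnot_word.
have lo_x k : (x + x 0 (lo j) *: delta_mx 0 (hi j)) 0 (lo k) = x 0 (lo k).
  by rewrite !mxE (negbTE (lo_neq_hi _ _)) andbF mulr0 addr0.
congr wpair; apply/rowP => k; first by rewrite mxE lo_x mxE.
rewrite mxE lo_x !mxE eqxx /= (inj_eq (@hi_inj m)) inE.
case: (eqVneq k j) => [->|_] /=; last by rewrite mulr0 addr0.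
by rewrite (negbTE njL) mul0r mulr1 mul1r addr0.
Qed.

Lemma sum_wpair m (F : word (2 ^ m.+1) -> C) :
  \sum_z F z = \sum_a \sum_b F (wpair a b).
Proof.
rewrite pair_big /= (reindex (fun ab => wpair ab.1 ab.2)) //.
exists (fun z => (lo_word z, hi_word z)) => [[a b] _|z _] /=.
  by rewrite lo_wpair hi_wpair.
by apply: word_lo_hi; rewrite ?lo_wpair ?hi_wpair.
Qed.

Lemma isometric_tensor2 m (A B : qop C (2 ^ m)) :
  isometric A -> isometric B -> isometric (tensor2 A B).
Proof.
move=> isoA isoB x y; rewrite sum_wpair.
transitivity (((lo_word x == lo_word y)%:R : C) * (hi_word x == hi_word y)%:R).
  rewrite -isoA -isoB mulr_suml; apply: eq_bigr => a _.
  rewrite mulr_sumr; apply: eq_bigr => b _.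
  by rewrite /tensor2 lo_wpair hi_wpair rmorphM mulrACA.
rewrite -natrM mulnb; congr (nat_of_bool _)%:R.
by apply/andP/eqP => [[/eqP lo_xy /eqP hi_xy]|->//]; apply: word_lo_hi.
Qed.

End Operators.

(** * The recursive step of the encoder *)

(* The basis words encoded by U(r, m) are indexed by these sets of variables. *)
Definition info r m : {set {set 'I_m}} :=
  [set S : {set 'I_m} | (m <= #|S| + r)%N && (#|S| <= r)%N].

Definition supported n (T : finType) (pos : T -> 'I_n) (I : {set T}) (x : word n) : Prop :=
  forall j, (forall S, S \in I -> pos S != j) -> x 0 j = 0.

(** Membership of [y] in the coset, modulo RM(r, m)^perp, of the sum of the x_S weighted by the bits
    of [x]: by [dual_RM] a coset is fixed by its coefficients at sets of size at least m - r. *)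
Definition matches r m (pos : {set 'I_m} -> 'I_(2 ^ m)) (y x : word (2 ^ m)) : bool :=
  [forall S : {set 'I_m}, (m <= #|S| + r)%N ==>
     (anf y S == if (#|S| <= r)%N then x 0 (pos S) else 0)].

Lemma matchesP r m (pos : {set 'I_m} -> 'I_(2 ^ m)) (y x : word (2 ^ m)) :
  reflect (forall S : {set 'I_m}, (m <= #|S| + r)%N ->
             anf y S = if (#|S| <= r)%N then x 0 (pos S) else 0)
          (matches r pos y x).
Proof.
by apply: (iffP forallP) => h S; [move/implyP: (h S) => hS /hS/eqP | apply/implyP => /h ->].
Qed.

(* In particular [U] maps a basis word to a multiple of the codeword state of the
   sum of the monomials x_S weighted by the bits at the positions [pos S]. *)
Definition encodes (C : numClosedFieldType) r m (pos : {set 'I_m} -> 'I_(2 ^ m))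
    (U : qop C (2 ^ m)) : Prop :=
  [/\ isometric U, {in info r m &, injective pos} &
      exists c, forall x, supported pos (info r m) x ->
        forall y, U y x = c * (matches r pos y x)%:R].

Lemma encodes_ext (C : numClosedFieldType) r m (pos : {set 'I_m} -> 'I_(2 ^ m))
    (U U' : qop C (2 ^ m)) :
  (forall y x, U y x = U' y x) -> encodes r pos U -> encodes r pos U'.
Proof.
move=> eqU [isoU inj [c UE]]; split=> //.
  by move=> x y; rewrite -(isoU x y); apply: eq_bigr => z _; rewrite !eqU.
by exists c => x sx y; rewrite -eqU UE.
Qed.

(** * One recursion step, common to U(m, m) and U(r, m) *)

Section Step.
Variables (C : numClosedFieldType) (r r1 m : nat) (H : {set {set 'I_m}}).
Variables (pos : {set 'I_m.+1} -> 'I_(2 ^ m.+1)) (pos1 : {set 'I_m} -> 'I_(2 ^ m)).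
Variables (p : {perm 'I_(2 ^ m.+1)}) (K : seq 'I_(2 ^ m.+1)) (L : seq 'I_(2 ^ m)).
Variable U1 : qop C (2 ^ m).

(** Here [r1] is the order of the shorter code and [H] the sets whose monomials are superposed by
    Hadamard gates: none for U(m, m), those of size m - r otherwise, m being the shorter length. The
    suffixes 0 and 1 refer to monomials without and with x_1. *)
Hypothesis zone0 : forall u : {set 'I_m},
  (m.+1 <= #|u| + r)%N = (m <= #|u| + r1)%N && (u \notin H).
Hypothesis val0 : forall u : {set 'I_m},
  (m <= #|u| + r1)%N -> u \notin H -> (#|u| <= r)%N = (#|u| <= r1)%N.
Hypothesis subH : forall u, u \in H -> u \in info r1 m.
Hypothesis zone1 : forall u : {set 'I_m}, (m <= #|u| + r)%N = (m <= #|u| + r1)%N.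
Hypothesis val1 : forall u : {set 'I_m}, (#|u| < r)%N -> (#|u| <= r1)%N.
Hypothesis p_lo : forall u, u \in info r1 m -> p (pos (up false u)) = lo (pos1 u).
Hypothesis p_hi : forall v : {set 'I_m}, v \in info r1 m -> (#|v| < r)%N ->
  p (pos (up true v)) = hi (pos1 v).
Hypothesis uniqK : uniq K.
Hypothesis memK : forall i, i \in K <-> exists2 h, h \in H & i = pos (up false h).
Hypothesis uniqL : uniq L.
Hypothesis memL : forall j, j \in L <-> exists2 u, u \in info r1 m & j = pos1 u.
Hypothesis encU1 : encodes r1 pos1 U1.

Let pos1_inj : {in info r1 m &, injective pos1}. Proof. by case: encU1. Qed.

Lemma info_up0 (u : {set 'I_m}) :
  up false u \in info r m.+1 -> u \in info r1 m /\ u \notin H.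
Proof.
rewrite inE card_up add0n zone0 => /andP[/andP[z1 nH] le_r]; split=> //.
by rewrite inE z1 -val0.
Qed.

Lemma info_up1 (u : {set 'I_m}) :
  up true u \in info r m.+1 -> u \in info r1 m /\ (#|u| < r)%N.
Proof.
rewrite inE card_up add1n addSn ltnS zone1 => /andP[z1 lt_r]; split=> //.
by rewrite inE z1 val1.
Qed.

Lemma pos_info_inj : {in info r m.+1 &, injective pos}.
Proof.
move=> S T; case: (up_surj S) => [[] [u ->]]; case: (up_surj T) => [[] [v ->]].
- move=> /info_up1[iu lu] /info_up1[iv lv] /(congr1 p); rewrite !p_hi // => /hi_inj.
  by move/pos1_inj => ->.
- move=> /info_up1[iu lu] /info_up0[iv _] /(congr1 p); rewrite p_hi // p_lo // => /esym/eqP.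
  by rewrite (negbTE (lo_neq_hi _ _)).
- move=> /info_up0[iu _] /info_up1[iv lv] /(congr1 p); rewrite p_hi // p_lo // => /eqP.
  by rewrite (negbTE (lo_neq_hi _ _)).
- move=> /info_up0[iu _] /info_up0[iv _] /(congr1 p); rewrite !p_lo // => /lo_inj.
  by move/pos1_inj => ->.
Qed.

Lemma pos_up0_K (u : {set 'I_m}) : u \in info r1 m -> pos (up false u) \in K -> u \in H.
Proof.
move=> iu /memK[h hH /(congr1 p)]; rewrite !p_lo ?(subH hH) // => /lo_inj.
by move/(pos1_inj iu (subH hH)) => ->.
Qed.

Lemma pos_up1_K (u : {set 'I_m}) :
  u \in info r1 m -> (#|u| < r)%N -> pos (up true u) \notin K.
Proof.
move=> iu lu; apply/negP => /memK[h hH /(congr1 p)]; rewrite p_hi // p_lo ?(subH hH) //.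
by move=> /esym/eqP; rewrite (negbTE (lo_neq_hi _ _)).
Qed.

Lemma pos_info_K S : S \in info r m.+1 -> pos S \notin K.
Proof.
case: (up_surj S) => [[] [u ->]]; first by case/info_up1 => iu lu; exact: pos_up1_K.
by case/info_up0 => iu nH; apply: contra nH; exact: pos_up0_K.
Qed.

Section Input.
Variables (x : word (2 ^ m.+1)).
Hypothesis sx : supported pos (info r m.+1) x.

Lemma input_K i : i \in K -> x 0 i = 0.
Proof.
by move=> iK; apply: sx => S iS; apply: contraTneq iK => <-; exact: pos_info_K.
Qed.

Section Branch.
Variable (x' : word (2 ^ m.+1)).
Hypothesis eq_x' : eq_off (mem K) x' x.
Let y1 := perm_word p x'.

Lemma branch_lo (u : {set 'I_m}) : u \in info r1 m -> y1 0 (lo (pos1 u)) = x' 0 (pos (up false u)).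
Proof. by move=> iu; rewrite mxE -p_lo // permK. Qed.

(** For |u| >= r this value of [p] is not prescribed. By injectivity of [p], the qubit arriving
    there is neither a Hadamard one nor one indexed by [info], hence it holds 0. *)
Lemma branch_hi (u : {set 'I_m}) : u \in info r1 m ->
  y1 0 (hi (pos1 u)) = if (#|u| < r)%N then x 0 (pos (up true u)) else 0.
Proof.
move=> iu; case: ifP => lu.
  by rewrite mxE -p_hi // permK (eq_offP _ _ _ eq_x') //; exact: pos_up1_K.
rewrite mxE; set i := (p^-1)%g _; have pi : p i = hi (pos1 u) by rewrite permKV.
have niK : i \notin K.
  apply/negP => /memK[h hH ei]; move: pi; rewrite ei p_lo ?(subH hH) // => /eqP.
  by rewrite (negbTE (lo_neq_hi _ _)).
rewrite (eq_offP _ _ _ eq_x') //; apply: sx => S; case: (up_surj S) => [[] [v ->]].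
  case/info_up1 => iv lv; apply/eqP => ev; move: pi; rewrite -ev p_hi // => /hi_inj.
  by move/(pos1_inj iv iu) => euv; move: lu; rewrite -euv lv.
case/info_up0 => iv _; apply/eqP => ev; move: pi; rewrite -ev p_lo // => /eqP.
by rewrite (negbTE (lo_neq_hi _ _)).
Qed.

(** Again by injectivity of [p], only an auxiliary qubit in state 0 can arrive here. *)
Lemma branch_lo0 j : (forall u, u \in info r1 m -> pos1 u != j) -> y1 0 (lo j) = 0.
Proof.
move=> nj; rewrite mxE; set i := (p^-1)%g _; have pi : p i = lo j by rewrite permKV.
have niK : i \notin K.
  apply/negP => /memK[h hH ei]; move: pi; rewrite ei p_lo ?(subH hH) // => /lo_inj/eqP.
  by rewrite (negbTE (nj _ _)) ?(subH hH).
rewrite (eq_offP _ _ _ eq_x') //; apply: sx => S; case: (up_surj S) => [[] [v ->]].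
  case/info_up1 => iv lv; apply/eqP => ev; move: pi; rewrite -ev p_hi // => /esym/eqP.
  by rewrite (negbTE (lo_neq_hi _ _)).
case/info_up0 => iv _; apply/eqP => ev; move: pi; rewrite -ev p_lo // => /lo_inj/eqP.
by rewrite (negbTE (nj _ _)).
Qed.

Lemma branch_hi0 j : (forall u, u \in info r1 m -> pos1 u != j) -> y1 0 (hi j) = 0.
Proof.
move=> nj; rewrite mxE; set i := (p^-1)%g _; have pi : p i = hi j by rewrite permKV.
have niK : i \notin K.
  apply/negP => /memK[h hH ei]; move: pi; rewrite ei p_lo ?(subH hH) // => /eqP.
  by rewrite (negbTE (lo_neq_hi _ _)).
rewrite (eq_offP _ _ _ eq_x') //; apply: sx => S; case: (up_surj S) => [[] [v ->]].
  case/info_up1 => iv lv; apply/eqP => ev; move: pi; rewrite -ev p_hi // => /hi_inj/eqP.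
  by rewrite (negbTE (nj _ _)).
case/info_up0 => iv _; apply/eqP => ev; move: pi; rewrite -ev p_lo // => /eqP.
by rewrite (negbTE (lo_neq_hi _ _)).
Qed.

Let y2 := cnot_word L y1.

Lemma supported_lo : supported pos1 (info r1 m) (lo_word y2).
Proof. by move=> j nj; rewrite lo_wpair mxE branch_lo0. Qed.

Lemma supported_hi : supported pos1 (info r1 m) (hi_word y2).
Proof. by move=> j nj; rewrite hi_wpair mxE branch_hi0 // branch_lo0 // mulr0 addr0. Qed.

Lemma lo_y2 (u : {set 'I_m}) : u \in info r1 m ->
  lo_word y2 0 (pos1 u) = x' 0 (pos (up false u)).
Proof. by move=> iu; rewrite lo_wpair mxE branch_lo. Qed.

Lemma hi_y2 (u : {set 'I_m}) : u \in info r1 m ->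
  hi_word y2 0 (pos1 u) =
  (if (#|u| < r)%N then x 0 (pos (up true u)) else 0) + x' 0 (pos (up false u)).
Proof.
move=> iu; rewrite hi_wpair mxE branch_hi // branch_lo //.
have -> : pos1 u \in L by apply/memL; exists u.
by rewrite mul1r.
Qed.

End Branch.

(* The only branch of the Hadamard gates that leads to [z]. *)
Definition branch (z : word (2 ^ m.+1)) : word (2 ^ m.+1) :=
  \row_i (if [pick h in H | pos (up false h) == i] is Some h
          then anf z (up false h) else x 0 i).

Lemma branch_H z h : h \in H -> branch z 0 (pos (up false h)) = anf z (up false h).
Proof.
move=> hH; rewrite mxE; case: pickP => [h' /andP[hH' /eqP/(congr1 p)]|/(_ h)].
  by rewrite !p_lo ?(subH hH) ?(subH hH') // => /lo_inj/(pos1_inj (subH hH') (subH hH)) ->.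
by rewrite hH eqxx.
Qed.

Lemma branch_off z i : i \notin K -> branch z 0 i = x 0 i.
Proof.
move=> niK; rewrite mxE; case: pickP => [h /andP[hH /eqP ei]|//].
by case/negP: niK; apply/memK; exists h.
Qed.

(** For [u] in [H], the Hadamard bit must be the coefficient of x_u in [z], which pins down [x'].
    The remaining equations are the same on both sides, since adding the two halves isolates the
    coefficient of x_1 x_u. *)
Lemma branch_unique z x' :
  eq_off (mem K) x' x &&
  (matches r1 pos1 (lo_word z) (lo_word (cnot_word L (perm_word p x'))) &&
   matches r1 pos1 (hi_word z) (hi_word (cnot_word L (perm_word p x')))) =
  matches r pos z x && (x' == branch z).
Proof.
have anf_hi u : anf (hi_word z) u = anf z (up true u) + anf z (up false u).
  by rewrite !anf_up mul1r mul0r addr0 addrAC F2_addxx add0r.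
have anf_lo u : anf (lo_word z) u = anf z (up false u).
  by rewrite anf_up mul0r addr0.
apply/and3P/andP => [[eq_x' /matchesP m_lo /matchesP m_hi]|[/matchesP mz /eqP eq_x']].
  split.
    apply/matchesP => S; case: (up_surj S) => [[] [u ->]]; rewrite card_up.
      rewrite add1n addSn ltnS zone1 => z1; move: (m_hi u z1) (m_lo u z1).
      rewrite anf_hi anf_lo; case: (leqP #|u| r1) => [le_u|lt_u]; last first.
        (* Above degree [r1] both coefficients vanish, and [val1] excludes |u| < r. *)
        move=> e1 e0; move: e1; rewrite e0 addr0 => ->.
        by case: ifP => // /val1; rewrite leqNgt lt_u.
      have iu : u \in info r1 m by rewrite inE z1.
      by rewrite lo_y2 // hi_y2 // => e1 e0; move: e1; rewrite e0 => /addIr.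
    rewrite add0n zone0 => /andP[z1 nH]; move: (m_lo u z1); rewrite anf_lo => ->.
    rewrite val0 //; case: ifP => // le_u.
    have iu : u \in info r1 m by rewrite inE z1.
    rewrite lo_y2 // (eq_offP _ _ _ eq_x') //; apply: contra nH; exact: pos_up0_K.
  apply/eqP/rowP => i; case: (boolP (i \in K)) => [/memK[h hH ->]|niK]; last first.
    by rewrite branch_off // (eq_offP _ _ _ eq_x').
  have ih := subH hH; move: (ih); rewrite inE => /andP[z1 le_h].
  by rewrite branch_H // -anf_lo m_lo // le_h lo_y2.
have eq_off_x' : eq_off (mem K) x' x.
  by apply/eq_offP => i niK; rewrite eq_x' branch_off.
have m0 (u : {set 'I_m}) : (m <= #|u| + r1)%N ->
    anf z (up false u) = if (#|u| <= r1)%N then x' 0 (pos (up false u)) else 0.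
  move=> z1; case: (boolP (u \in H)) => [uH|nH].
    have := subH uH; rewrite inE => /andP[_ le_u].
    by rewrite eq_x' branch_H //; case: ifP => // /negP[].
  rewrite mz card_up add0n ?zone0 ?z1 // val0 //; case: ifP => // le_u.
  rewrite eq_x' branch_off //; apply: contra nH; apply: pos_up0_K.
  by rewrite inE z1.
have m1 (u : {set 'I_m}) : (m <= #|u| + r1)%N ->
    anf z (up true u) = if (#|u| < r)%N then x 0 (pos (up true u)) else 0.
  by move=> z1; rewrite mz card_up add1n // addSn ltnS zone1.
split=> //; apply/matchesP => u z1; rewrite ?anf_lo ?anf_hi.
  rewrite m0 //; case: ifP => // le_u; rewrite lo_y2 // inE z1 le_u //.
rewrite m0 // m1 //; case: (leqP #|u| r1) => [le_u|lt_u].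
  by rewrite hi_y2 // inE z1.
by rewrite addr0; case: ifP => // /val1; rewrite leqNgt lt_u.
Qed.

End Input.

(** The amplitude is a sum over the words [x'] following the Hadamard layer, of which
    [branch_unique] leaves one. *)
Lemma encodes_step :
  encodes r pos (circuit [:: circuit [seq @hadamard C _ i | i <- K]; perm_op C p;
    circuit [seq cnot C (lo j) (hi j) | j <- L]; tensor2 U1 U1]).
Proof.
case: (encU1) => isoU1 _ [c1 U1E]; split.
- do 4?[apply: isometric_then].
  + by apply: circuit_map_isometric => i; exact: isometric_hadamard.
  + exact: isometric_perm.
  + by apply: circuit_map_isometric => j; apply: isometric_cnot; exact: lo_neq_hi.
  + exact: isometric_tensor2.
  + exact: isometric_id.
- exact: pos_info_inj.
(* One factor per Hadamard gate, and one [c1] per half. *)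
exists ((sqrtC 2%:R)^-1 ^+ size K * (c1 * c1)) => x sx z.
pose D := circuit [seq @hadamard C _ i | i <- K].
pose N := circuit [seq cnot C (lo j) (hi j) | j <- L].
rewrite -[LHS]/(\sum_x'
  then_op (perm_op C p) (then_op N (then_op (tensor2 U1 U1) id_op)) z x' * D x' x).
transitivity (\sum_x' (x' == branch x z)%:R *
   ((sqrtC 2%:R)^-1 ^+ size K * (c1 * c1) * (matches r pos z x)%:R)); last first.
  by rewrite sum_pred1.
apply: eq_bigr => x' _.
rewrite (then_graph _ (perm_opE C p)) (then_graph _ (fun y x => circuit_cnot C y x uniqL)).
rewrite then_id /D circuit_hadamard //; last by move=> i; exact: input_K.
rewrite [RHS]mulrC -[RHS]mulrA -natrM mulnb -branch_unique //.
case: (boolP (eq_off _ _ _)) => [eq_x'|_]; last by rewrite !mulr0.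
rewrite mulr1 /tensor2 !U1E; [|exact: (supported_hi sx eq_x')|exact: (supported_lo sx eq_x')].
by rewrite mulrACA -natrM mulnb [LHS]mulrC mulrA.
Qed.

End Step.

(** * The recursive encoders satisfy [encodes] *)

Definition mono_pos m (M : seq (word (2 ^ m))) (S : {set 'I_m}) : 'I_(2 ^ m) :=
  Defs.index_map M (mono S).

Section EncoderEncodes.
Variables (C : numClosedFieldType) (G : int -> forall m, seq (word (2 ^ m))).
Hypothesis hG : monomial_rows G.

(** Without variables, the single bit is its own only coefficient. *)
Lemma encodes_00 (M : seq (word (2 ^ 0))) : encodes 0 (mono_pos M) (@id_op C (2 ^ 0)).
Proof.
have ord1_eq (i j : 'I_(2 ^ 0)) : i = j.
  by apply: val_inj; case: i j => [[|//] ?] [[|//] ?].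
split; first exact: isometric_id.
  by move=> S T _ _ _; apply/setP => -[].
exists 1 => x _ y; rewrite mul1r /id_op; congr (nat_of_bool _)%:R.
have anfE (z : word (2 ^ 0)) S j : anf z S = z 0 j.
  rewrite /anf (big_pred1 j) // => k; rewrite (ord1_eq k j) /= eqxx.
  by apply/subsetP => -[].
apply/eqP/matchesP => [-> S _|eq_yx].
  by rewrite (anfE _ _ (mono_pos M S)) (leq_trans (max_card _)) ?card_ord.
apply/rowP => j; rewrite -(anfE _ set0) eq_yx // cards0 leq0n.
by rewrite (ord1_eq j (mono_pos M set0)).
Qed.

Lemma mem_rows_info (r r1 m : nat) (d : int) (v : word (2 ^ m)) : d = m%:Z - r1%:Z - 1 ->
  v \in rows_diff (G r m) (G d m) <->
  exists2 S : {set 'I_m}, (m <= #|S| + r1)%N && (#|S| <= r)%N & v = mono S.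
Proof.
move=> ->; rewrite mem_rows_diff //; split=> -[S PS ->]; exists S => //.
  by apply/andP; move/andP: PS => [h1 h2]; split; [move: h1 | move: h2]; card_lia.
by apply/andP; move/andP: PS => [h1 h2]; split; [move: h1 | move: h2]; card_lia.
Qed.

Lemma cnot_halvesE m (M1 us : seq (word (2 ^ m))) :
  cnot_halves C M1 us =
  circuit [seq cnot C (lo j) (hi j) | j <- [seq Defs.index_map M1 u | u <- us]].
Proof. by rewrite /cnot_halves -map_comp. Qed.

Section Controls.
Variables (r m : nat) (M1 us : seq (word (2 ^ m))) (U1 : qop C (2 ^ m)).
Hypothesis encU1 : encodes r (mono_pos M1) U1.
Hypothesis us_uniq : uniq us.
Hypothesis mem_us : forall v, v \in us <-> exists2 S, S \in info r m & v = mono S.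

Lemma controls_uniq : uniq [seq Defs.index_map M1 u | u <- us].
Proof.
rewrite map_inj_in_uniq // => u v /mem_us[S iS ->] /mem_us[T iT ->].
by case: encU1 => _ inj _ /(inj _ _ iS iT) ->.
Qed.

Lemma mem_controls j : j \in [seq Defs.index_map M1 u | u <- us] <->
  exists2 u, u \in info r m & j = mono_pos M1 u.
Proof.
split=> [/mapP[u /mem_us[S iS ->] ->]|[S iS ->]]; first by exists S.
by apply: map_f; apply/mem_us; exists S.
Qed.

End Controls.

Lemma encodes_full m (M1 : seq (word (2 ^ m))) (U1 : qop C (2 ^ m))
    (p : {perm 'I_(2 ^ m.+1)}) (M : seq (word (2 ^ m.+1))) :
  encodes m (mono_pos M1) U1 ->
  (forall u, u \in G m m -> p (Defs.index_map M (wpair u u)) = lo (Defs.index_map M1 u)) ->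
  (forall v, v \in G m m -> p (Defs.index_map M (wpair 0 v)) = hi (Defs.index_map M1 v)) ->
  encodes m.+1 (mono_pos M)
    (circuit [:: perm_op C p; cnot_halves C M1 (G m m); tensor2 U1 U1]).
Proof.
move=> encU1 p_lo p_hi.
have le_m (S : {set 'I_m}) : (#|S| <= m)%N by rewrite -[X in (_ <= X)%N]card_ord max_card.
have monoG S : mono S \in G m m by rewrite mono_in_G // lez_nat.
have mem_us v : v \in G m m <-> exists2 S, S \in info m m & v = mono S.
  split=> [/(mem_G hG)[S _ ->]|[S _ ->] //]; exists S => //.
  by rewrite inE leq_addl le_m.
rewrite cnot_halvesE.
(* There are no Hadamard gates here: [H] and [K] are empty, and [encodes_ext] removes the resulting
   empty layer. *)
have := @encodes_step C m.+1 m m set0 (mono_pos M) (mono_pos M1) p [::]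
  [seq Defs.index_map M1 u | u <- G m m] U1.
move=> step; apply: encodes_ext (step _ _ _ _ _ _ _ _ _ _ _ _).
- by move=> y x; apply: (then_graph _ (f := id)).
- by move=> u; rewrite inE andbT !leq_addl.
- by move=> u _ _; rewrite !leqW ?le_m.
- by move=> u; rewrite inE.
- by move=> u; rewrite !leq_addl addnS leqW ?leq_addl.
- by move=> u; rewrite le_m.
- by move=> u _; rewrite /mono_pos -mono_up0 p_lo.
- by move=> u _ _; rewrite /mono_pos -mono_up1 p_hi.
- by [].
- by move=> i; split=> // -[h]; rewrite inE.
- by apply: controls_uniq encU1 _ mem_us; case: (hG m m).
- exact: mem_controls mem_us.
- exact: encU1.
Qed.

(** The rows (g, g) come last in [M], so their indices are exactly those on which the Hadamard gates
    act. *)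
Lemma encodes_rec r m (M1 : seq (word (2 ^ m))) (U1 : qop C (2 ^ m))
    (p : {perm 'I_(2 ^ m.+1)}) (d : int) (M : seq (word (2 ^ m.+1))) (k : nat) :
  d = m.+1%:Z - r%:Z - 1 ->
  M = rows_diff (G r m.+1) (G d m.+1) ++
      [seq wpair g g | g <- rows_diff (G d m) (G (d - 1) m)] ->
  k = (\sum_(m.+1 - r <= i < r.+1) 'C(m.+1, i))%N ->
  (m <= r.*2)%N -> (r < m.+1)%N ->
  encodes r (mono_pos M1) U1 ->
  (forall u, u \in rows_diff (G r m) (G (d - 1) m) ->
     p (Defs.index_map M (wpair u u)) = lo (Defs.index_map M1 u)) ->
  (forall v, v \in rows_diff (G (r%:Z - 1) m) (G (d - 1) m) ->
     p (Defs.index_map M (wpair 0 v)) = hi (Defs.index_map M1 v)) ->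
  encodes r (mono_pos M)
    (circuit [:: @hadamards C (2 ^ m.+1) k (k + 'C(m, m.+1 - r - 1)); perm_op C p;
      cnot_halves C M1 (rows_diff (G r m) (G (d - 1) m)); tensor2 U1 U1]).
Proof.
move=> dE ME kE le_r lt_r encU1 p_lo p_hi.
set A := rows_diff (G r m.+1) (G d m.+1) in ME.
set B := [seq wpair g g | g <- _] in ME.
have dE' : d - 1 = m%:Z - r%:Z - 1 by rewrite dE; lia.
have memA v : v \in A <->
    exists2 S : {set 'I_m.+1}, (m.+1 <= #|S| + r)%N && (#|S| <= r)%N & v = mono S.
  exact: mem_rows_info.
have memB v : v \in B <->
    exists2 h : {set 'I_m}, (#|h| + r == m)%N & v = mono (up false h).
  split=> [/mapP[g]|[h eq_h ->]].
    move=> /(mem_rows_diff hG)[h /andP[h1 h2] ->] ->; exists h; last by rewrite mono_up0.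
    by move: h1 h2; rewrite dE; card_lia.
  rewrite -mono_up0; apply: map_f; apply/(mem_rows_diff hG); exists h => //.
  by apply/andP; rewrite dE; split; move: eq_h; card_lia.
have subM : {subset M <= codom (@mono m.+1)}.
  move=> v; rewrite ME mem_cat => /orP[/memA|/memB] [S _ ->]; exact: codom_f.
(* The rows (g, g) have degree m - r, one less than the least degree in [A]. *)
have notA (h : {set 'I_m}) : (#|h| + r == m)%N -> mono (up false h) \notin A.
  move=> eq_h; apply/negP => /memA[S /andP[h1 _] /mono_word_inj eS].
  by move: h1 eq_h; rewrite -eS card_up; card_lia.
have uniqM : uniq M.
  rewrite ME cat_uniq rows_diff_uniq //= map_inj_uniq ?rows_diff_uniq //; last first.
    by move=> u v /(congr1 (@lo_word m)); rewrite !lo_wpair.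
  by rewrite andbT; apply/hasPn => v /memB[h eq_h ->]; exact: notA.
have sizeA : size A = k.
  rewrite size_rows_diff // kE -card_sets_sum; apply: eq_card => S; rewrite !inE.
  by rewrite dE ltnS; congr (_ && _); card_lia.
have sizeB : size B = 'C(m, m.+1 - r - 1).
  rewrite size_map size_rows_diff // -[m in 'C(m, _)]card_ord -card_draws.
  by apply: eq_card => S; rewrite !inE dE; card_lia.
have mem_us v : v \in rows_diff (G r m) (G (d - 1) m) <->
    exists2 S, S \in info r m & v = mono S.
  by rewrite (mem_rows_info _ _ dE'); split=> -[S PS ->]; exists S; rewrite ?inE // inE in PS *.
rewrite cnot_halvesE.
apply: (@encodes_step C r r m [set h : {set 'I_m} | #|h| + r == m]%N).
- by move=> u; rewrite inE; card_lia.
- by [].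
- by move=> u; rewrite !inE; card_lia.
- by [].
- by move=> u /ltnW.
- move=> u iu; rewrite /mono_pos -mono_up0 p_lo //; apply/mem_us; by exists u.
- move=> u; rewrite inE => /andP[h1 h2] lt_u; rewrite /mono_pos -mono_up1 p_hi //.
  apply/(mem_rows_diff hG); exists u => //.
  by apply/andP; rewrite dE'; split; [move: h1 | move: lt_u]; card_lia.
- by rewrite filter_uniq ?enum_uniq.
- move=> i; rewrite mem_filter mem_enum andbT; split=> [/andP[ge_k lt_k]|[h]].
    have lt_i : (i < size M)%N by rewrite ME size_cat sizeA sizeB.
    have : nth 0 M i \in B.
      rewrite ME nth_cat sizeA ltnNge ge_k /=; apply: mem_nth.
      by rewrite sizeB ltn_subLR.
    move=> /memB[h eq_h ei]; exists h; first by rewrite inE.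
    apply: val_inj; rewrite /= /mono_pos -ei index_mapE ?index_uniq //; exact: mem_nth.
  rewrite inE => eq_h ->.
  have hB : mono (up false h) \in B by apply/memB; exists h.
  rewrite /mono_pos index_mapE //; last by rewrite ME mem_cat hB orbT.
  rewrite ME index_cat (negbTE (notA _ eq_h)) sizeA leq_addr ltn_add2l -sizeB.
  by rewrite index_mem.
- by apply: controls_uniq encU1 _ mem_us; exact: rows_diff_uniq.
- exact: mem_controls mem_us.
- exact: encU1.
Qed.

Lemma encoder_encodes r m (M : seq (word (2 ^ m))) (U : qop C (2 ^ m)) :
  encoder G r M U -> encodes r (mono_pos M) U.
Proof.
elim=> {r m M U} [|m M1 U1 p M _ IH p_lo p_hi|r m M1 U1 p n d M k G3 le_r lt_r _ IH p_lo p_hi].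
- exact: encodes_00.
- exact: encodes_full.
- rewrite subn1 /=; apply: encodes_rec (IH) p_lo p_hi => //.
  by move: le_r; rewrite subn1.
Qed.

End EncoderEncodes.

(** * Restriction to the parts Q(s; t) *)

Lemma sorted_enum_ord n (A : {pred 'I_n}) : sorted (fun a b : 'I_n => a < b)%N (enum A).
Proof.
apply: sorted_filter; first by move=> a b c; exact: ltn_trans.
have := iota_ltn_sorted 0 n; rewrite -val_enum_ord sorted_map enumT; exact.
Qed.

(** The variables outside [s] are taken in increasing order, to agree with the increasing
    enumeration of Q(s; t) in [Q_nth]. *)
Lemma complement_enum m l (s : l.-tuple 'I_m) : uniq s ->
  exists v : 'I_(m - l) -> 'I_m,
    [/\ forall i k : 'I_(m - l), (i < k)%N -> (v i < v k)%N,
        forall i, v i \notin s &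
        forall k, k \notin s -> exists i, k = v i].
Proof.
move=> us; pose A := [pred k | k \notin s].
have cardA : (m - l = #|A|)%N.
  have eqA : #|A| = #|[predC mem s]| by apply: eq_card.
  have := cardC (mem s); rewrite card_ord (card_uniqP us) size_tuple -eqA; card_lia.
exists (fun i => enum_val (cast_ord cardA i)); split.
- move=> i k lt_ik; set x0 := enum_val (cast_ord cardA i).
  rewrite /x0 !(enum_val_nth x0).
  apply: (sorted_ltn_nth _ _ (sorted_enum_ord A)) => //; rewrite ?inE -?cardE -?cardA //.
  by move=> a b c; exact: ltn_trans.
- by move=> i; have := enum_valP (cast_ord cardA i); rewrite inE.
- move=> k nk; have kA : k \in A by [].
  exists (cast_ord (esym cardA) (enum_rank_in kA k)).
  by rewrite cast_ordKV enum_rankK_in.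
Qed.

Definition ones l (t : l.-tuple 'F_2) : {set 'I_l} := [set i | tnth t i == 1].

Lemma ones_inj l : injective (@ones l).
Proof.
move=> t t' eq_tt'; apply: eq_from_tnth => i.
have : (i \in ones t) = (i \in ones t') by rewrite eq_tt'.
by rewrite !inE; case: (F2_cases (tnth t i)) (F2_cases (tnth t' i)) => -> [] ->.
Qed.

Section Parts.
Variables (m l : nat) (s : l.-tuple 'I_m) (v : 'I_(m - l) -> 'I_m).
Hypothesis us : uniq s.
Hypothesis v_mono : forall i k : 'I_(m - l), (i < k)%N -> (v i < v k)%N.
Hypothesis v_notin : forall i, v i \notin s.
Hypothesis v_surj : forall k, k \notin s -> exists i, k = v i.

(* the variables s_i, i \in A, together with those outside s selected by S *)
Definition join (A : {set 'I_l}) (S : {set 'I_(m - l)}) : {set 'I_m} :=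
  [set tnth s i | i in A] :|: [set v k | k in S].

Lemma v_inj : injective v.
Proof.
move=> i k eq_v; case: (ltngtP i k) => [/v_mono|/v_mono|/val_inj //];
  by rewrite eq_v ltnn.
Qed.

Lemma tnth_inj_s : injective (tnth s).
Proof. exact/tuple_uniqP. Qed.

Lemma in_join_s A S i : (tnth s i \in join A S) = (i \in A).
Proof.
rewrite in_setU (mem_imset _ _ tnth_inj_s) orbC; case: imsetP => //= -[k _ e].
by move: (v_notin k); rewrite -e mem_tnth.
Qed.

Lemma in_join_v A S k : (v k \in join A S) = (k \in S).
Proof.
rewrite in_setU (mem_imset _ _ v_inj); case: imsetP => //= -[i _ e].
by move: (v_notin k); rewrite e mem_tnth.
Qed.

Lemma s_v_cases (k : 'I_m) : (exists i, k = tnth s i) \/ (exists i, k = v i).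
Proof.
case: (boolP (k \in s)) => [/tnthP[i ->]|/v_surj[i ->]]; [left | right]; by exists i.
Qed.

Lemma join_ext (T : {set 'I_m}) (A : {set 'I_l}) (S : {set 'I_(m - l)}) :
  (forall i, (tnth s i \in T) = (i \in A)) -> (forall k, (v k \in T) = (k \in S)) ->
  T = join A S.
Proof.
move=> Ts Tv; apply/setP => k.
by case: (s_v_cases k) => -[i ->]; rewrite ?in_join_s ?in_join_v.
Qed.

Lemma join_surj (T : {set 'I_m}) : exists A S, T = join A S.
Proof.
exists [set i | tnth s i \in T], [set k | v k \in T].
by apply: join_ext => i; rewrite inE.
Qed.

Lemma subset_join A S B T : (join A S \subset join B T) = (A \subset B) && (S \subset T).
Proof.
apply/subsetP/andP => [sub|[/subsetP AB /subsetP ST] k].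
  split; apply/subsetP => i; first by rewrite -(in_join_s A S) => /sub; rewrite in_join_s.
  by rewrite -(in_join_v A S) => /sub; rewrite in_join_v.
by case: (s_v_cases k) => -[i ->]; rewrite ?in_join_s ?in_join_v; [move/AB | move/ST].
Qed.

Lemma join_inj A S B T : join A S = join B T -> A = B /\ S = T.
Proof.
move=> e; split; apply/setP => i; first by rewrite -(in_join_s A S) e in_join_s.
by rewrite -(in_join_v A S) e in_join_v.
Qed.

Lemma card_join A S : #|join A S| = (#|A| + #|S|)%N.
Proof.
rewrite cardsU !card_imset; try exact: v_inj; try exact: tnth_inj_s.
rewrite (_ : _ :&: _ = set0) ?cards0 ?subn0 //; apply/setP => k; rewrite !inE.
by apply/andP => -[/imsetP[i _ ->] /imsetP[k' _ e]]; move: (v_notin k'); rewrite -e mem_tnth.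
Qed.

(* Q(s; t) is enumerated increasingly, and v is increasing, so that the bits outside
   s of its j-th element are those of j. *)
Lemma supp_Q_nth t j : supp (Q_nth s t j) = join (ones t) (supp j).
Proof.
case: (supp_bij m) => g _ gK.
(* [psi] is the expected enumeration: being increasing with image Q(s; t), it must coincide with
   that of [enum]. *)
pose psi (k : 'I_(2 ^ (m - l))) := g (join (ones t) (supp k)).
have psiK k : supp (psi k) = join (ones t) (supp k) by rewrite gK.
have psi_mono (j1 j2 : 'I_(2 ^ (m - l))) : (j1 < j2)%N -> (psi j1 < psi j2)%N.
  move=> /lt_first_bit[i [eq_lt ni yi]]; apply: (@lt_supp _ _ _ (v i)); rewrite ?psiK ?in_join_v //.
  move=> k lt_k; case: (s_v_cases k) => -[k' ek]; rewrite ?psiK ek ?in_join_s ?in_join_v //.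
  apply: eq_lt; rewrite ltnNge leq_eqVlt; apply/negP => /orP[/eqP/val_inj ei|/v_mono].
    by move: lt_k; rewrite ek ei ltnn.
  by rewrite -ek ltnNge ltnW.
have enumQ : enum (Q s t) = [seq psi k | k <- enum 'I_(2 ^ (m - l))].
  apply: (@irr_sorted_eq _ (fun a b : 'I_(2 ^ m) => a < b)%N).
  - by move=> a b c; exact: ltn_trans.
  - by move=> a; exact: ltnn.
  - exact: sorted_enum_ord.
  - rewrite sorted_map; apply: (sub_sorted (e := fun a b : 'I_(2 ^ (m - l)) => a < b)%N).
      by move=> a b; exact: psi_mono.
    exact: sorted_enum_ord.
  move=> q; rewrite mem_enum; apply/bigcapP/mapP => [inQ|[k _ ->] i _]; last first.
    rewrite inE mxE mevalXU rhoE psiK in_join_s inE.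
    by case: (F2_cases (tnth t i)) => ->.
  case: (join_surj (supp q)) => A [S eq_q].
  case: (supp_bij (m - l)) => h _ hK; exists (h S); first by rewrite mem_enum.
  apply: supp_inj; rewrite psiK hK eq_q; congr join; apply/setP => i; rewrite inE.
  have := inQ i isT; rewrite inE mxE mevalXU rhoE eq_q in_join_s => /eqP <-.
  by case: (i \in A).
rewrite /Q_nth enumQ (nth_map j) ?size_enum_ord // psiK; congr (join _ (supp _)).
by apply: val_inj; rewrite /= nth_enum_ord.
Qed.

Hypothesis le_lm : (l <= m)%N.

Lemma Q_nth_bij : bijective (fun tj => Q_nth s tj.1 tj.2).
Proof.
apply: inj_card_bij => [[t j] [t' j'] /= /(congr1 (@supp m))|].
  by rewrite !supp_Q_nth => /join_inj[/ones_inj -> /supp_inj ->].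
by rewrite card_prod card_tuple !card_ord -expnD subnKC.
Qed.

Lemma word_eq_parts (x y : word (2 ^ m)) : (forall t, Q_word s t x = Q_word s t y) -> x = y.
Proof.
move=> eq_xy; apply/rowP => q; case: Q_nth_bij => g _ gK; rewrite -(gK q).
by have /rowP/(_ (g q).2) := eq_xy (g q).1; rewrite !mxE.
Qed.

Lemma Q_word_bij :
  bijective (fun y : word (2 ^ m) => [ffun t : l.-tuple 'F_2 => Q_word s t y]).
Proof.
apply: inj_card_bij => [x y /ffunP eq_xy|].
  by apply: word_eq_parts => t; move: (eq_xy t); rewrite !ffunE.
rewrite card_ffun card_tuple !card_mx !card_ord !mul1n -expnM -expnD.
by rewrite subnK.
Qed.

Lemma Q_wordD t (x y : word (2 ^ m)) : Q_word s t (x + y) = Q_word s t x + Q_word s t y.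
Proof. by apply/rowP => j; rewrite !mxE. Qed.

Lemma Q_word0 t : Q_word s t 0 = 0.
Proof. by apply/rowP => j; rewrite !mxE. Qed.

Lemma anf_join (y : word (2 ^ m)) A S :
  anf y (join A S) = \sum_(t | ones t \subset A) anf (Q_word s t y) S.
Proof.
rewrite /anf (reindex _ (onW_bij _ Q_nth_bij)) /= pair_big_dep /=.
rewrite big_mkcond [RHS]big_mkcond; apply: eq_bigr => -[t j] _ /=.
by rewrite supp_Q_nth subset_join mxE.
Qed.

(** Moebius inversion of [anf_join] with respect to [A]. *)
Lemma anf_part (y : word (2 ^ m)) t S :
  anf (Q_word s t y) S = \sum_(A : {set 'I_l} | A \subset ones t) anf y (join A S).
Proof.
under eq_bigr => A _ do rewrite anf_join.
rewrite (exchange_big_dep xpredT) //=.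
under eq_bigr => t' _.
  rewrite (eq_bigr (fun=> anf (Q_word s t' y) S * 1)) => [|A _]; last by rewrite mulr1.
  rewrite -mulr_sumr.
  rewrite (eq_bigl (fun A : {set _} => (ones t' \subset A) && (A \subset ones t))); last first.
    by move=> A; rewrite andbC.
  rewrite sum_interval (inj_eq (@ones_inj l)).
  over.
rewrite (bigD1 t) //= eqxx mulr1 big1 ?addr0 // => t' /negbTE ->.
by rewrite mulr0.
Qed.

Lemma Q_word_mono t (S : {set 'I_(m - l)}) : Q_word s t (mono (join set0 S)) = mono S.
Proof.
by apply/rowP => j; rewrite !mxE supp_Q_nth subset_join sub0set.
Qed.

(** Words correspond to families of words on the parts, so the sum of products factors into a
    product of sums. *)
Lemma isometric_on_parts (C : numClosedFieldType) (U : qop C (2 ^ (m - l))) :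
  isometric U -> isometric (on_parts s U).
Proof.
move=> isoU x y.
pose F (t : l.-tuple 'F_2) (z : word (2 ^ (m - l))) :=
  (U z (Q_word s t x))^* * U z (Q_word s t y).
transitivity (\sum_(f : {ffun l.-tuple 'F_2 -> word (2 ^ (m - l))}) \prod_t F t (f t)).
  rewrite [RHS](reindex _ (onW_bij _ Q_word_bij)) /=; apply: eq_bigr => z _.
  rewrite /on_parts rmorph_prod -big_split /=; apply: eq_bigr => t _.
  by rewrite /F ffunE.
rewrite -bigA_distr_bigA /=.
under eq_bigr => t _ do rewrite /F isoU.
case: (eqVneq x y) => [->|neq]; first by rewrite big1 // => t _; rewrite eqxx.
have [t neq_t] : exists t, Q_word s t x != Q_word s t y.
  apply/existsP; apply: contraNT neq => /existsPn eq_xy; apply/eqP/word_eq_parts => t.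
  by have := eq_xy t; rewrite negbK => /eqP.
by rewrite (bigD1 t) //= (negbTE neq_t) mul0r.
Qed.

End Parts.

(** * The decoded state *)

Lemma dual_RM_D r m (x y : word (2 ^ m)) :
  x \in dual_code (RM r%:Z m) -> y \in dual_code (RM r%:Z m) ->
  x + y \in dual_code (RM r%:Z m).
Proof.
move=> /dual_RM dx /dual_RM dy; apply/dual_RM => S leS.
by rewrite anfD dx // dy // addr0.
Qed.

Lemma flipped_ghzE (C : numClosedFieldType) l (b x : party_word l) :
  flipped_ghz (C := C) b x =
  (sqrtC 2%:R)^-1 * [exists c : 'F_2, forall t, x t + b t == c]%:R.
Proof.
rewrite /flipped_ghz /ghz; congr (_ * _); rewrite -natrD; congr (_%:R).
have eqE c : [forall t, [ffun t => x t + b t] t == c] = [forall t, x t + b t == c].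
  by apply: eq_forallb => t; rewrite ffunE.
(* There is at least one party, even for l = 0, so the two terms of the GHZ state exclude each
   other. *)
rewrite !eqE; pose t0 : l.-tuple 'F_2 := [tuple of nseq l 0].
case: (boolP [exists c, _]) => [/existsP[c xc]|]; last first.
  rewrite negb_exists => /forallP nx.
  by rewrite (negbTE (nx 0)) (negbTE (nx 1)).
have only c' : [forall t, x t + b t == c'] = (c' == c).
  apply/forallP/eqP => [/(_ t0)/eqP <-|-> t]; last exact: (forallP xc).
  exact/eqP/(forallP xc).
by rewrite !only; case: (F2_cases c) => ->.
Qed.

(** A product that is nonzero at both words of the support, [mix 0 0] and [mix 1 1], is nonzero at
    [mix 0 1] too, where the state vanishes. *)
Lemma flipped_ghz_entangled (C : numClosedFieldType) l (b : party_word l) :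
  entangled (flipped_ghz (C := C) b).
Proof.
move=> A /set0Pn[t0 At0] nAT [f [g [f_A g_A fgE]]].
have [t1 nAt1] : exists t, t \notin A.
  apply/existsP; apply: contraNT nAT => /existsPn nA; apply/eqP/setP => t.
  by have := nA t; rewrite negbK inE => ->.
pose mix c c' : party_word l := [ffun t => b t + (if t \in A then c else c')].
have nz c : flipped_ghz (C := C) b (mix c c) != 0.
  rewrite flipped_ghzE mulf_neq0 ?invr_neq0 ?sqrt2_neq0 //.
  have -> : [exists c0, forall t, mix c c t + b t == c0].
    by apply/existsP; exists c; apply/forallP => t; rewrite ffunE if_same addrAC F2_addxx add0r.
  by rewrite oner_neq0.
have f_mix : f (mix 0 1) = f (mix 0 0) by apply: f_A => t At; rewrite !ffunE At.
have g_mix : g (mix 0 1) = g (mix 1 1).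
  by apply: g_A => t; rewrite inE => /negbTE At; rewrite !ffunE At.
have : flipped_ghz (C := C) b (mix 0 1) != 0.
  have := nz 0; have := nz 1; rewrite !fgE f_mix g_mix !mulf_eq0 !negb_or.
  by move=> /andP[_ ->] /andP[->].
rewrite flipped_ghzE (_ : [exists c, _] = false) ?mulr0 ?eqxx //.
apply/existsP => -[c /forallP xc].
have := eqP (xc t0); have := eqP (xc t1); rewrite !ffunE At0 (negbTE nAt1) => <- /eqP.
by rewrite addr0 [b t1 + _ + _]addrAC !F2_addxx add0r eq_sym oner_eq0.
Qed.

Section Decoding.
Variables (C : numClosedFieldType) (r m l : nat) (s : l.-tuple 'I_m) (v : 'I_(m - l) -> 'I_m).
Hypothesis us : uniq s.
Hypothesis v_mono : forall i k : 'I_(m - l), (i < k)%N -> (v i < v k)%N.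
Hypothesis v_notin : forall i, v i \notin s.
Hypothesis v_surj : forall k, k \notin s -> exists i, k = v i.
Hypothesis le_lm : (l <= m)%N.
Hypothesis l_gt0 : (0 < l)%N.
Hypothesis hr : (m - 1 <= r.*2)%N.
Hypothesis hrm : (r <= m)%N.
Variables (pos : {set 'I_(m - l)} -> 'I_(2 ^ (m - l))) (U : qop C (2 ^ (m - l))).
Let r' := minn r (m - l).
Hypothesis encU : encodes r' pos U.

Local Notation D := (dual_code (RM r%:Z m)).
Local Notation join := (join s v).

Let pos_inj : {in info r' (m - l) &, injective pos}. Proof. by case: encU. Qed.

Let anf_partE := anf_part us v_mono v_notin v_surj le_lm.
Let anf_joinE := anf_join us v_mono v_notin v_surj le_lm.
Let card_joinE := card_join us v_mono v_notin.

Lemma card_le_part (S : {set 'I_(m - l)}) : (#|S| <= m - l)%N.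
Proof. by rewrite -[X in (_ <= X)%N](card_ord (m - l)) max_card. Qed.

(* the input that the decoder of one part recovers from the word [z] *)
Definition decoded_word (z : word (2 ^ (m - l))) : word (2 ^ (m - l)) :=
  \row_j (if [pick T in info r' (m - l) | pos T == j] is Some T then anf z T else 0).

Lemma decoded_word_pos z S : S \in info r' (m - l) -> decoded_word z 0 (pos S) = anf z S.
Proof.
move=> iS; rewrite mxE; case: pickP => [T /andP[iT /eqP/(pos_inj iT iS)->]//|/(_ S)].
by rewrite iS eqxx.
Qed.

Lemma decoded_word_supported z : supported pos (info r' (m - l)) (decoded_word z).
Proof.
move=> j nj; rewrite mxE; case: pickP => [S /andP[iS eS]|//].
by move: (nj S iS); rewrite eS.
Qed.

Lemma decoded_wordP x z : supported pos (info r' (m - l)) x ->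
  (forall S, S \in info r' (m - l) -> x 0 (pos S) = anf z S) -> x = decoded_word z.
Proof.
move=> sx xpos; apply/rowP => j; rewrite mxE; case: pickP => [S /andP[iS /eqP <-]|nj].
  exact: xpos.
by apply: sx => S iS; move: (nj S); rewrite iS /= => ->.
Qed.

Lemma matches_decoded x z : supported pos (info r' (m - l)) x ->
  matches r' pos z x -> x = decoded_word z.
Proof.
move=> sx /matchesP mx; apply: decoded_wordP => // S; rewrite inE => /andP[z1 le_S].
by rewrite mx // le_S.
Qed.

(** As |S| <= m - l, the assumption forces r' = r. All contributing coefficients of [y] then have
    degree above r, where [w] has none, nor has [y + w] since m - 1 <= 2r. *)
Lemma coset_part_high w y t (S : {set 'I_(m - l)}) : w \in RM r%:Z m -> y + w \in D ->
  (r' < #|S|)%N -> anf (Q_word s t y) S = 0.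
Proof.
move=> RMw /dual_RM Dyw lt_S; have leS := card_le_part S.
rewrite anf_partE big1 // => A _; have cJ := card_joinE A S.
have /Dyw : (m <= #|join A S| + r)%N by move: hr lt_S; rewrite /r'; card_lia.
rewrite anfD (Eval_anf RMw) ?addr0 //.
by move: lt_S; rewrite /r' ltz_nat; card_lia.
Qed.

(** At most l variables of [T] occur in [s], so [anf z T] is a sum of coefficients of parts at sets
    of size at least m - l - r'. *)
Lemma dual_of_parts z :
  (forall t (S : {set 'I_(m - l)}), (m - l <= #|S| + r')%N -> anf (Q_word s t z) S = 0) -> z \in D.
Proof.
move=> zt; apply/dual_RM => T leT.
case: (join_surj us v_mono v_notin v_surj T) => A [S eT].
rewrite eT anf_joinE big1 // => t _; apply: zt.
have cA : (#|A| <= l)%N by rewrite -[X in (_ <= X)%N](card_ord l) max_card.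
by move: leT; rewrite eT card_joinE /r'; card_lia.
Qed.

(* the computational basis states occurring in the decoded state *)
Definition decoded_words (w : word (2 ^ m)) : {set word (2 ^ m)} :=
  [set x | [exists y, (y + w \in D) &&
     [forall t, Q_word s t x == decoded_word (Q_word s t y)]]].

Lemma decoded_wordsP w x :
  reflect (exists2 y, y + w \in D & forall t, Q_word s t x = decoded_word (Q_word s t y))
          (x \in decoded_words w).
Proof.
rewrite inE; apply: (iffP existsP) => -[y].
  by case/andP => Dy /forallP xE; exists y => // t; apply/eqP.
by move=> Dy xE; exists y; rewrite Dy; apply/forallP => t; rewrite xE.
Qed.

(** Each [y] in the coset of [w] comes from exactly one decoded word, and other [y] from none:
    encoding the uniform sum over [decoded_words w] gives the codeword state up to a scalar. *)
Lemma sum_decoded_words w y : w \in RM r%:Z m ->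
  \sum_(x in decoded_words w) \prod_t (matches r' pos (Q_word s t y) (Q_word s t x))%:R =
  (y + w \in D)%:R :> C.
Proof.
move=> RMw.
(* The only candidate glues together the words decoded in the parts. *)
have [g gE] : exists g : word (2 ^ m), forall t, Q_word s t g = decoded_word (Q_word s t y).
  case: (Q_word_bij us v_mono v_notin v_surj le_lm) => glue _ glueK.
  exists (glue [ffun t => decoded_word (Q_word s t y)]) => t.
  by have /ffunP/(_ t) := glueK [ffun t => decoded_word (Q_word s t y)]; rewrite !ffunE.
have only_g x : x \in decoded_words w ->
    [forall t, matches r' pos (Q_word s t y) (Q_word s t x)] = (x == g) && (y + w \in D).
  move=> /decoded_wordsP[y' Dy' xE]; apply/forallP/andP => [mx|[/eqP -> Dy] t]; last first.
    rewrite gE; apply/matchesP => S zS; case: ifP => leS.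
      by rewrite decoded_word_pos // inE zS.
    by apply: (coset_part_high _ RMw Dy); rewrite ltnNge leS.
  have xg t : Q_word s t x = decoded_word (Q_word s t y).
    by apply: matches_decoded => //; rewrite xE; exact: decoded_word_supported.
  split; first by apply/eqP/(word_eq_parts us v_mono v_notin v_surj le_lm) => t; rewrite xg gE.
  (* [y] and [y'] decode alike in every part, so [dual_of_parts] applies to their sum. *)
  have -> : y + w = (y + y') + (y' + w) by rewrite addrA -[y + y' + y']addrA F2_addbb addr0.
  apply: dual_RM_D => //; apply: dual_of_parts => t S zS; rewrite Q_wordD anfD.
  have /matchesP/(_ S zS) -> := mx t; case: ifP => leS; last first.
    by rewrite add0r (coset_part_high _ RMw Dy') // ltnNge leS.
  by rewrite xE decoded_word_pos ?F2_addxx // inE zS.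
transitivity (\sum_(x in decoded_words w) ((x == g) && (y + w \in D))%:R : C).
  apply: eq_bigr => x Xx; rewrite -only_g //.
  exact: (prodr_bool C (fun t => matches r' pos (Q_word s t y) (Q_word s t x))).
case: (boolP (y + w \in D)) => [Dy|_]; last by rewrite big1 // => x _; rewrite andbF.
have Xg : g \in decoded_words w by apply/decoded_wordsP; exists y.
rewrite (bigD1 g) //= eqxx big1 ?addr0 // => x /andP[_ /negbTE ->] //.
Qed.

(** Once the codeword state is written as an encoded sum over [decoded_words w], the isometry
    property cancels the decoder. *)
Lemma decode_codeword w : w \in RM r%:Z m ->
  exists c : C, forall x,
    decode s U (codeword_state r w) x = c * (x \in decoded_words w)%:R.
Proof.
move=> RMw; case: (encU) => isoU _ [c UE].
(* Otherwise the column of [U] at the zero word would vanish. *)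
have c_neq0 : c != 0.
  apply/eqP => c0; have := isoU 0 0; rewrite eqxx big1 => [/eqP|z _].
    by rewrite eq_sym oner_eq0.
  by rewrite UE ?c0 ?mul0r ?mulr0 // => j _; rewrite mxE.
pose c' := c ^+ #|{: l.-tuple 'F_2}|.
pose n : C := (sqrtC #|D|%:R)^-1.
have stateE y : codeword_state r w y = n / c' * \sum_(x in decoded_words w) on_parts s U y x.
  transitivity (n * (y + w \in D)%:R).
    rewrite /codeword_state; congr (_ * _).
    case: (boolP (y + w \in D)) => [Dyw|nDyw].
      rewrite (bigD1 (y + w)) //= addrCA F2_addbb addr0 eqxx big1 ?addr0 // => x /andP[_ neq].
      by case: (y =P w + x) neq => // ->; rewrite [w + x]addrC -addrA F2_addbb addr0 eqxx.
    rewrite big1 // => x Dx; case: eqP => // e; case/negP: nDyw.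
    by rewrite e [w + x]addrC -addrA F2_addbb addr0.
  rewrite -(sum_decoded_words y RMw) -mulrA; congr (_ * _); rewrite mulr_sumr.
  apply: eq_bigr => x /decoded_wordsP[y' _ xE].
  have -> : on_parts s U y x =
      c' * \prod_t (matches r' pos (Q_word s t y) (Q_word s t x))%:R.
    rewrite /on_parts /c' -prodr_const -big_split; apply: eq_bigr => t _ /=.
    by rewrite UE // xE; exact: decoded_word_supported.
  by rewrite mulrA mulVf ?mul1r // expf_neq0.
exists (n / c') => x; rewrite /decode /app_op.
transitivity (n / c' * \sum_(x' in decoded_words w)
    \sum_y (on_parts s U y x)^* * on_parts s U y x').
  rewrite exchange_big mulr_sumr /=; apply: eq_bigr => y _.
  by rewrite stateE mulrCA -mulr_sumr; congr (_ * (_ * _)); rewrite /on_parts rmorph_prod.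
congr (_ * _).
under eq_bigr => x' _ do rewrite (isometric_on_parts us v_mono v_notin v_surj le_lm isoU).
case: (boolP (x \in _)) => [Xx|nXx].
  by rewrite (bigD1 x) //= eqxx big1 ?addr0 // => x' /andP[_ /negbTE]; rewrite eq_sym => ->.
by rewrite big1 // => x' Xx'; case: eqP Xx' nXx => // -> ->.
Qed.

Variables (K : nat) (Sa : 'I_K -> {set 'I_(m - l)}).
Hypothesis Sa_inj : injective Sa.
Hypothesis mem_Sa : forall S : {set 'I_(m - l)}, (#|S|.+1 + r == m)%N <-> exists a, S = Sa a.

Lemma card_Sa a : (#|Sa a|.+1 + r = m)%N.
Proof. by apply/eqP/mem_Sa; exists a. Qed.

(** The bound m - 1 <= 2r gives m - r - 1 <= r, so this degree is among the decoded ones. *)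
Lemma Sa_info a : Sa a \in info r' (m - l).
Proof.
have cS := card_Sa a; have leS := card_le_part (Sa a).
by rewrite inE /r'; apply/andP; split; move: hr; card_lia.
Qed.

Lemma pos_Sa_inj : injective (fun a => pos (Sa a)).
Proof. by move=> a b /(pos_inj (Sa_info a) (Sa_info b))/Sa_inj. Qed.

Definition off_eq (x x' : word (2 ^ m)) : Prop :=
  forall t j, (forall a, pos (Sa a) != j) -> x 0 (Q_nth s t j) = x' 0 (Q_nth s t j).

(** The support of the [a]-th flipped GHZ state, the flips being coefficients of [w]. *)
Definition share_const (w x : word (2 ^ m)) (a : 'I_K) : bool :=
  [exists c : 'F_2, forall t : l.-tuple 'F_2,
     x 0 (Q_nth s t (pos (Sa a))) + anf (Q_word s t w) (Sa a) == c].

Lemma share_const_add w x x' a t t' : share_const w x a -> share_const w x' a ->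
  x 0 (Q_nth s t (pos (Sa a))) + x' 0 (Q_nth s t (pos (Sa a))) =
  x 0 (Q_nth s t' (pos (Sa a))) + x' 0 (Q_nth s t' (pos (Sa a))).
Proof.
move=> /existsP[c /forallP xc] /existsP[c' /forallP xc'].
have E t1 : x 0 (Q_nth s t1 (pos (Sa a))) + x' 0 (Q_nth s t1 (pos (Sa a))) = c + c'.
  rewrite -(eqP (xc t1)) -(eqP (xc' t1)) addrACA [anf _ _ + _]F2_addxx addr0 //.
by rewrite !E.
Qed.

(* A monomial of degree m - r - 1 in the variables outside s is not affected by those in
   s, since multiplying it by one of these leaves RM(m - r - 1, m). *)
Lemma coset_share z t a : z \in D -> anf (Q_word s t z) (Sa a) = anf z (join set0 (Sa a)).
Proof.
move=> /dual_RM Dz; rewrite anf_partE (bigD1 set0) ?sub0set //= big1 ?addr0 // => A /andP[_ nA].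
have := card_joinE A (Sa a); have := card_Sa a; rewrite -card_gt0 in nA.
by move=> c1 c2; apply: Dz; move: nA; card_lia.
Qed.

Lemma decoded_words_share w x a : x \in decoded_words w -> share_const w x a.
Proof.
move=> /decoded_wordsP[y Dy xE]; apply/existsP; exists (anf (y + w) (join set0 (Sa a))).
apply/forallP => t; rewrite -(coset_share t a Dy) Q_wordD anfD.
have /rowP/(_ (pos (Sa a))) := xE t; rewrite decoded_word_pos ?Sa_info // mxE => ->.
by [].
Qed.

(** Membership splits into one test per shared state and a test on the other qubits, which yields
    the tensor product. Conversely, a preimage [y'] of [x'] is corrected by monomials of degree m -
    r - 1, which lie in the dual code. *)
Lemma decoded_words_off w x : x \in decoded_words w <->
  (forall a, share_const w x a) /\ exists2 x', x' \in decoded_words w & off_eq x x'.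
Proof.
split=> [Xx|[sx [x' Xx' eq_xx']]].
  by split=> [a|]; [exact: decoded_words_share | exists x].
have sx' a := decoded_words_share a Xx'.
case/decoded_wordsP: Xx' => y' Dy' x'E.
pose t0 : l.-tuple 'F_2 := [tuple of nseq l 0].
(* The correction is read in one part; [share_const_add] makes it the same in all. *)
pose dl a := x 0 (Q_nth s t0 (pos (Sa a))) + x' 0 (Q_nth s t0 (pos (Sa a))).
pose f := \sum_a dl a *: mono (join set0 (Sa a)).
have anf_f t S : anf (Q_word s t f) S = \sum_a dl a * (Sa a == S)%:R.
  have -> : Q_word s t f = \sum_a dl a *: mono (Sa a).
    apply/rowP => j; rewrite mxE !summxE; apply: eq_bigr => a _.
    by rewrite -(Q_word_mono us v_mono v_notin v_surj t) !mxE.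
  by rewrite anf_sum; apply: eq_bigr => a _; rewrite anfZ anf_mono.
apply/decoded_wordsP; exists (y' + f).
  rewrite addrAC; apply: dual_RM_D => //; apply/dual_RM => T leT.
  rewrite anf_sum big1 // => a _; rewrite anfZ anf_mono; case: eqP => [eT|_]; last by rewrite mulr0.
  have := card_joinE set0 (Sa a); rewrite cards0 eT; have := card_Sa a.
  by move: leT; card_lia.
move=> t; have x't := x'E t; apply: decoded_wordP => [j nj|S iS].
  rewrite mxE eq_xx' => [|a]; last exact: nj (Sa_info a).
  by have := @decoded_word_supported (Q_word s t y') j nj; rewrite -x't mxE.
rewrite Q_wordD anfD anf_f -decoded_word_pos // -x't !mxE.
(* At the sets [Sa a] the correction turns the bit of [x'] into that of [x]; elsewhere the two words
   already agree. *)
case: (pselect (exists a, S = Sa a)) => [[a ->]|nS].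
  rewrite (bigD1 a) //= eqxx mulr1 big1 ?addr0 => [|b nb]; last first.
    by rewrite (inj_eq Sa_inj) (negbTE nb) mulr0.
  rewrite /dl (share_const_add t0 t (sx a) (sx' a)) addrCA F2_addxx addr0 //.
rewrite big1 ?addr0 => [|a _]; last first.
  by case: eqP => [eS|_]; [case: nS; exists a | rewrite mulr0].
apply: eq_xx' => a; apply/eqP => /(pos_inj (Sa_info a) iS) eS.
by apply: nS; exists a.
Qed.

Lemma decode_obtains w : w \in RM r%:Z m ->
  obtains s (fun a => flipped_ghz (C := C) [ffun t => anf (Q_word s t w) (Sa a)])
    (decode s U (codeword_state r w)).
Proof.
move=> RMw; case: (decode_codeword RMw) => c decE.
exists (fun a _ => pos (Sa a)).
(* [chi] tests whether the other qubits extend to a decoded word; the power of [sqrtC 2] compensates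
   the normalization of the [K] GHZ states. *)
exists (fun x => c * sqrtC 2%:R ^+ K *
  (`[< exists2 x', x' \in decoded_words w & off_eq x x' >])%:R).
split=> [t|x x' eq_xx'|x].
- exact: pos_Sa_inj.
- congr (_ * (nat_of_bool _)%:R); apply: asbool_equiv_eq.
  by split=> -[x1 X1 eq1]; exists x1 => // t j nj; rewrite -eq1 // eq_xx'.
have -> : \prod_a flipped_ghz [ffun t => anf (Q_word s t w) (Sa a)]
      (share_word s (fun a _ => pos (Sa a)) a x) =
    (sqrtC 2%:R)^-1 ^+ K * [forall a, share_const w x a]%:R :> C.
  rewrite -[K in X in X * _]card_ord -prodr_const.
  transitivity (\prod_a ((sqrtC (2%:R : C))^-1 * (share_const w x a)%:R)).
    apply: eq_bigr => a _; rewrite flipped_ghzE; congr (_ * (nat_of_bool _)%:R).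
    by apply: eq_existsb => c1; apply: eq_forallb => t; rewrite !ffunE.
  by rewrite big_split (prodr_bool C (share_const w x)).
rewrite decE [RHS]mulrACA.
have -> : (sqrtC 2%:R)^-1 ^+ K * (c * sqrtC 2%:R ^+ K) = c.
  by rewrite mulrCA exprVn mulVf ?mulr1 // expf_neq0 // sqrt2_neq0.
rewrite -natrM mulnb; congr (_ * (nat_of_bool _)%:R).
apply/idP/andP => [|[/forallP sx /asboolP ex]].
  by move=> /decoded_words_off[sx ex]; split; [apply/forallP | apply/asboolP].
by apply/decoded_words_off.
Qed.

End Decoding.

(** * Counting the shared states and assembling the result *)

Lemma card_levels m l r : (r <= m)%N ->
  #|[set S : {set 'I_(m - l)} | #|S|.+1 + r == m]%N| = binz (m - l) (m%:Z - r%:Z - 1).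
Proof.
move=> le_rm; case: (ltnP r m) => [lt_rm|le_mr].
  have -> : m%:Z - r%:Z - 1 = Posz (m - r - 1)%N by lia.
  rewrite /=; have := card_draws 'I_(m - l) (m - r - 1)%N; rewrite card_ord => <-.
  have levelE c : (c.+1 + r == m)%N = (c == m - r - 1)%N by lia.
  by apply: eq_card => S; rewrite !inE; exact: levelE.
(* For r = m the degree is -1, and no set qualifies. *)
have -> : m%:Z - r%:Z - 1 = Negz 0 by lia.
have levelE c : (c.+1 + r == m)%N = false by lia.
by apply: eq_card0 => S; rewrite !inE; exact: levelE.
Qed.

Lemma enum_levels m l r K :
  #|[set S : {set 'I_(m - l)} | #|S|.+1 + r == m]%N| = K ->
  exists Sa : 'I_K -> {set 'I_(m - l)}, injective Sa /\
    forall S : {set 'I_(m - l)}, (#|S|.+1 + r == m)%N <-> exists a, S = Sa a.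
Proof.
move=> cK; exists (fun a => enum_val (cast_ord (esym cK) a)); split.
  by move=> a b /enum_val_inj/cast_ord_inj.
move=> S; split=> [mS|[a ->]]; last by have := enum_valP (cast_ord (esym cK) a); rewrite inE.
have inS : S \in [set S : {set 'I_(m - l)} | #|S|.+1 + r == m]%N by rewrite inE.
by exists (cast_ord cK (enum_rank_in inS S)); rewrite cast_ordK enum_rankK_in.
Qed.

Lemma le_size_uniq m l (s : l.-tuple 'I_m) : uniq s -> (l <= m)%N.
Proof.
move=> us; have := max_card (mem s).
by rewrite card_ord (card_uniqP us) size_tuple.
Qed.

Section Obtained.
Variables (C : numClosedFieldType) (G : int -> forall m : nat, seq (word (2 ^ m))).
Hypothesis hG : monomial_rows G.
Variables (r m : nat).
Hypotheses (hr : (m - 1 <= r.*2)%N) (hrm : (r <= m)%N).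

(** The sets [Sa] do not depend on the codeword; only the flips do. *)
Lemma codeword_obtains l (s : l.-tuple 'I_m) (M : seq (word (2 ^ (m - l))))
    (U : qop C (2 ^ (m - l))) :
  (0 < l)%N -> uniq s -> encoder G (minn r (m - l)) M U ->
  exists Sa : 'I_(binz (m - l) (m%:Z - r%:Z - 1)) -> {set 'I_(m - l)},
  forall w, w \in RM r m ->
    obtains s (fun a => flipped_ghz (C := C) [ffun t => anf (Q_word s t w) (Sa a)])
      (decode s U (codeword_state r w)).
Proof.
move=> l_gt0 us encU; have [v [v_mono v_notin v_surj]] := complement_enum us.
have [Sa [Sa_inj mem_Sa]] := enum_levels (card_levels l hrm).
exists Sa => w RMw.
exact: (decode_obtains us v_mono v_notin v_surj (le_size_uniq us) l_gt0 hr hrm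
  (encoder_encodes hG encU) Sa_inj mem_Sa).
Qed.

Lemma flipped_ghz0 l (x : party_word l) :
  flipped_ghz (C := C) [ffun=> 0] x = ghz x.
Proof.
by rewrite /flipped_ghz; congr ghz; apply/ffunP => t; rewrite !ffunE addr0.
Qed.

Lemma obtains_ext l (s : l.-tuple 'I_m) k (eta eta' : 'I_k -> party_state C l)
    (psi : qstate C (2 ^ m)) :
  (forall a x, eta a x = eta' a x) -> obtains s eta psi -> obtains s eta' psi.
Proof.
move=> eq_eta [e [chi [e_inj chi_ext psiE]]]; exists e, chi; split=> // x.
by rewrite psiE; congr (_ * _); apply: eq_bigr => a _; rewrite eq_eta.
Qed.

(** With one cut variable, a decoded coefficient at a set other than the [Sa a] has degree at least
    m - r, where the dual code has none. The other qubits are thus all in state 0, a product across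
    the parts. *)
Lemma bell_pairs (i : 'I_m) (M : seq (word (2 ^ (m - 1)))) (U : qop C (2 ^ (m - 1))) :
  (r < m - 1)%N -> encoder G r M U ->
  obtains_exactly [tuple i] (fun _ : 'I_('C(m - 1, m - r - 1)) => bell_pair)
    (decode [tuple i] U (codeword_state r 0)).
Proof.
move=> lt_r encU; set s := [tuple i]; have us : uniq s by [].
have [v [v_mono v_notin v_surj]] := complement_enum us.
have lm := le_size_uniq us.
have card_eq : #|[set S : {set 'I_(m - 1)} | #|S|.+1 + r == m]%N| = 'C(m - 1, m - r - 1).
  by rewrite card_levels // (_ : m%:Z - r%:Z - 1 = Posz (m - r - 1)%N) //; lia.
have [Sa [Sa_inj mem_Sa]] := enum_levels card_eq.
have encU' : encodes (minn r (m - 1)) (mono_pos M) U.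
  by rewrite (minn_idPl (ltnW lt_r)); exact: (encoder_encodes hG encU).
have RM0' : 0 \in RM r m by exact: RM0.
have [c decE] := decode_codeword us v_mono v_notin v_surj lm (ltn0Sn 0) hr hrm encU' RM0'.
set X := decoded_words _ _ _ _ in decE.
pose off (z : word (2 ^ (m - 1))) :=
  [forall (j | [forall a, mono_pos M (Sa a) != j]), z 0 j == 0].
have offP (z : word (2 ^ (m - 1))) :
    reflect (forall j, (forall a, mono_pos M (Sa a) != j) -> z 0 j = 0) (off z).
  apply: (iffP forall_inP) => [oz j nj|oz j /forallP nj]; last exact/eqP/oz.
  by apply/eqP/oz/forallP.
have X_off x t : x \in X -> off (Q_word s t x).
  move=> /decoded_wordsP[y]; rewrite addr0 => /dual_RM Dy xE; apply/offP => j nj.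
  rewrite xE mxE; case: pickP => [S /andP[iS /eqP eS]|//].
  rewrite (anf_part us v_mono v_notin v_surj lm) big1 // => A _; apply: Dy.
  rewrite (card_join us v_mono v_notin); move: iS; rewrite inE => /andP[z1 _].
  have : (#|S|.+1 + r == m)%N = false.
    by apply/negP => /mem_Sa[a eSa]; move: (nj a); rewrite -eSa eS eqxx.
  by move: z1; rewrite (minn_idPl (ltnW lt_r)); card_lia.
have X0 : 0 \in X.
  apply/decoded_wordsP; exists 0 => [|t].
    by rewrite addr0; apply/dual_RM => S _; rewrite anf0.
  rewrite Q_word0; apply/esym/rowP => j; rewrite !mxE.
  by case: pickP => // S _; rewrite anf0.
(* The part [t0] carries the global scalar. *)
have t0 : 1.-tuple 'F_2 := [tuple 0].
pose k := 'C(m - 1, m - r - 1).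
exists (fun a _ => mono_pos M (Sa a)).
exists (fun t z => (if t == t0 then c * sqrtC 2%:R ^+ k else 1) * (off z)%:R).
split=> [t|t x x' eq_xx'|x].
- exact: (pos_Sa_inj s lm (ltn0Sn 0) hr hrm encU' Sa_inj mem_Sa).
- congr (_ * (nat_of_bool _)%:R); apply/offP/offP => ox j nj.
    by rewrite -eq_xx' ?ox.
  by rewrite eq_xx' ?ox.
rewrite [X in _ * X]big_split /= [X in _ * (X * _)](bigD1 t0) //= eqxx.
rewrite [X in _ * (_ * X * _)]big1 ?mulr1; last by move=> t /negbTE ->.
have -> : \prod_(a < k) bell_pair (share_word s (fun a _ => mono_pos M (Sa a)) a x) =
    (sqrtC 2%:R)^-1 ^+ k * [forall a, share_const s (mono_pos M) Sa 0 x a]%:R :> C.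
  rewrite -[k in X in X * _]card_ord -prodr_const.
  transitivity (\prod_a ((sqrtC (2%:R : C))^-1 * (share_const s (mono_pos M) Sa 0 x a)%:R)).
    apply: eq_bigr => a _; rewrite /bell_pair -flipped_ghz0 flipped_ghzE.
    congr (_ * (nat_of_bool _)%:R).
    by apply: eq_existsb => c1; apply: eq_forallb => t; rewrite !ffunE Q_word0 anf0.
  by rewrite big_split (prodr_bool C (share_const s (mono_pos M) Sa 0 x)).
rewrite (prodr_bool C (fun t => off (Q_word s t x))) decE [RHS]mulrACA.
have -> : (sqrtC 2%:R)^-1 ^+ k * (c * sqrtC 2%:R ^+ k) = c.
  by rewrite mulrCA exprVn mulVf ?mulr1 // expf_neq0 // sqrt2_neq0.
rewrite -natrM mulnb; congr (_ * (nat_of_bool _)%:R).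
have X_iff := decoded_words_off us v_mono v_notin v_surj lm (ltn0Sn 0) hr hrm encU' Sa_inj mem_Sa.
apply/idP/andP => [Xx|[/forallP sx /forallP ox]].
  split; apply/forallP => a; last exact: X_off.
  by case: (iffLR (X_iff 0 x) Xx).
(* The zero word is the decoded word agreeing with [x] outside the pairs. *)
apply/(X_iff 0 x); split=> //; exists 0 => // t j nj; rewrite [RHS]mxE.
by have /offP/(_ j nj) := ox t; rewrite mxE.
Qed.

End Obtained.

Theorem mainTheorem10 (C : numClosedFieldType)
    (G : int -> forall m : nat, seq (word (2 ^ m))) (hG : monomial_rows G)
    (r m : nat) (hr : (m - 1 <= r.*2)%N) (hrm : (r <= m)%N) :
  (* entangled qubits from every |w>_{r,m}; [minn r (m - l)] because RM(r, m') is
     the whole space, i.e. RM(m', m'), for r >= m' *)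
  (forall (l : nat) (s : l.-tuple 'I_m)
      (M : seq (word (2 ^ (m - l)))) (U : qop C (2 ^ (m - l)))
      (w : word (2 ^ m)),
      (0 < l)%N -> uniq s -> encoder G (minn r (m - l)) M U ->
      w \in RM r m ->
      exists b : 'I_(binz (m - l) (m%:Z - r%:Z - 1)) -> party_word l,
        (forall a, entangled (flipped_ghz (C := C) (b a))) /\
        obtains s (fun a => flipped_ghz (b a)) (decode s U (codeword_state r w)))
  /\
  (* Bell pairs across Q(1;0), Q(1;1) from |0>_{r,m} *)
  (forall (i : 'I_m) (M : seq (word (2 ^ (m - 1)))) (U : qop C (2 ^ (m - 1))),
      (r < m - 1)%N -> i = 0%N :> nat -> encoder G r M U ->
      obtains_exactly [tuple i]
        (fun _ : 'I_('C(m - 1, m - r - 1)) => bell_pair)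
        (decode [tuple i] U (codeword_state r 0)))
  /\
  (* GHZ states from |0>_{r,m} *)
  (forall (l : nat) (s : l.-tuple 'I_m)
      (M : seq (word (2 ^ (m - l)))) (U : qop C (2 ^ (m - l))),
      (0 < l)%N -> uniq s -> encoder G (minn r (m - l)) M U ->
      obtains s
        (fun _ : 'I_(binz (m - l) (m%:Z - r%:Z - 1)) => ghz)
        (decode s U (codeword_state r 0))).
Proof.
split=> [l s M U w l_gt0 us encU RMw|].
  have [Sa obt] := codeword_obtains hG hr hrm l_gt0 us encU.
  (* The flips are the coefficients, at the shared monomials, of the restrictions of [w]; they
     vanish for w = 0. *)
  exists (fun a => [ffun t => anf (Q_word s t w) (Sa a)]).
  by split=> [a|]; [exact: flipped_ghz_entangled | exact: obt].
split=> [i M U lt_r _ encU|l s M U l_gt0 us encU].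
  exact: (bell_pairs hG hr hrm i lt_r encU).
have [Sa obt] := codeword_obtains hG hr hrm l_gt0 us encU.
apply: obtains_ext (obt 0 (RM0 _ _)) => a x.
rewrite (_ : [ffun t => _] = [ffun=> 0]) ?flipped_ghz0 //.
by apply/ffunP => t; rewrite !ffunE Q_word0 anf0.
Qed.
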